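(* Let $\Omega=(a,b)$ with real numbers $a<b$. For all $u\in H^1(\Omega)$, all grid sizes $h$ and all $p\in\mathbb{N}$ with $hp<|\Omega|$, there is a spline approximation $u_{p,h}\in\widetilde{S}_{p,h}(\Omega)$ such that $$\|u-u_{p,h}\|_{L^2(\Omega)}\le\sqrt{2}\,h\,|u|_{H^1(\Omega)}.$$
   Context: $\mathbb{N}=\{1,2,3,\ldots\}$, $\mathbb{N}_0=\mathbb{N}\cup\{0\}$, $|\Omega|=b-a$. A grid size for $\Omega=(a,b)$ is a real $h>0$ such that $n_h:=h^{-1}(b-a)\in\mathbb{N}$. $H^r(\Omega)$ is the standard Sobolev space ($H^0=L^2$) and $|u|_{H^r(\Omega)}:=\|\frac{\partial^r}{\partial x^r}u\|_{L^2(\Omega)}$. $\mathbb{P}^p$ is the space of polynomials of degree at most $p$, and $$S_{p,h}(\Omega):=\{u\in H^p(\Omega): u|_{(a+hj,a+h(j+1)]}\in\mathbb{P}^p\text{ for all }j=0,\ldots,n_h-1\}.$$ The space of splines with vanishing odd derivatives, $\widetilde{S}_{p,h}(\Omega)$, is the space of all $u_{p,h}\in S_{p,h}(\Omega)$ satisfying $$\frac{\partial^{2l+1}}{\partial x^{2l+1}}u_{p,h}(a)=\frac{\partial^{2l+1}}{\partial x^{2l+1}}u_{p,h}(b)=0\quad\text{for all }l\in\mathbb{N}_0\text{ with }2l+1<p.$$ *)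

(* Defs.v *)
(* MathComp-Analysis *)
From HB Require Import structures.
From mathcomp Require Import all_boot all_order all_algebra.
From mathcomp Require Import all_classical all_reals all_analysis.

Set Implicit Arguments.
Unset Strict Implicit.
Unset Printing Implicit Defensive.

Import Order.TTheory GRing.Theory Num.Theory.
Import numFieldNormedType.Exports.

Local Open Scope classical_set_scope.
Local Open Scope ring_scope.

(* Elements of L^2(Omega) and H^r(Omega) are represented by functions R -> R,
   whose values outside Omega are irrelevant. *)

Definition L2 (R : realType) (Omega : set R) (f : R -> R) : Prop :=
  f \_ Omega \in Lfun (@lebesgue_measure R) 2%:E.

Definition L2norm (R : realType) (Omega : set R) (f : R -> R) : \bar R :=
  Lnorm (@lebesgue_measure R) 2%:E (EFin \o (f \_ Omega)).

(* C^infty functions with compact support in Omega *)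
Definition test_function (R : realType) (Omega : set R) (phi : R -> R) : Prop :=
  [/\ forall n x, derivable (derive1n n phi) x 1,
      compact (closure [set x | phi x != 0]) &
      closure [set x | phi x != 0] `<=` Omega].

(* g is a weak derivative of order k of u on the open set Omega *)
Definition is_weak_deriv (R : realType) (Omega : set R) (k : nat)
    (u g : R -> R) : Prop :=
  [/\ locally_integrable Omega u, locally_integrable Omega g &
      forall phi, test_function Omega phi ->
        Rintegral (@lebesgue_measure R) Omega (fun x => u x * derive1n k phi x)
        = (-1) ^+ k *
          Rintegral (@lebesgue_measure R) Omega (fun x => g x * phi x)].

(* A choice of weak derivative; unique up to equality a.e. on Omega, and
   meaningful only when a weak derivative exists. *)
Definition weak_deriv (R : realType) (Omega : set R) (k : nat) (u : R -> R) :
    R -> R :=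
  xget (fun=> 0) [set g | is_weak_deriv Omega k u g].

Definition sobolev (R : realType) (Omega : set R) (r : nat) (u : R -> R) :
    Prop :=
  L2 Omega u /\
  forall k, (0 < k <= r)%N -> exists2 g, is_weak_deriv Omega k u g & L2 Omega g.

Definition sobolev_seminorm (R : realType) (Omega : set R) (r : nat)
    (u : R -> R) : \bar R :=
  L2norm Omega (weak_deriv Omega r u).

Definition grid_size (R : realType) (a b h : R) : Prop :=
  0 < h /\ exists2 n : nat, (0 < n)%N & h^-1 * (b - a) = n%:R.

(* n_h; the truncation is exact when h is a grid size *)
Definition grid_num (R : realType) (a b h : R) : nat :=
  Num.truncn (h^-1 * (b - a)).

Definition spline (R : realType) (a b : R) (p : nat) (h : R) (u : R -> R) :
    Prop :=
  sobolev `]a, b[ p u /\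
  forall j, (j < grid_num a b h)%N ->
    exists2 q : {poly R}, (size q <= p.+1)%N &
      {in `]a + h * j%:R, a + h * j.+1%:R], forall x, u x = q.[x]}.

(* The k-th derivative of u takes the value v at the point c of [a, b]: for
   u in H^r(a, b) and k < r, the value of a derivative at a point is that of
   its representative which is continuous up to the boundary. *)
Definition deriv_value (R : realType) (a b : R) (k : nat) (u : R -> R)
    (c v : R) : Prop :=
  exists g : R -> R, [/\ is_weak_deriv `]a, b[ k u g,
    {within `[a, b], continuous g} & g c = v].

Definition reduced_spline (R : realType) (a b : R) (p : nat) (h : R)
    (u : R -> R) : Prop :=
  spline a b p h u /\
  forall l, (l.*2.+1 < p)%N ->
    deriv_value a b l.*2.+1 u a 0 /\ deriv_value a b l.*2.+1 u b 0.

(* Main.v *)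
(** The error is propagated through the degree by duality. Besides the spline
    space with vanishing odd derivatives, consider the one with vanishing even
    derivatives; up to constants and a mean-value condition, integration maps
    each of them onto the other one of the next degree. Let U have derivative
    g, let s0 be the L^2 projection of g onto the space of degree p and of the
    other parity, and let e be the difference of U and the appropriate
    antiderivative of s0, so that e' = g - s0 is orthogonal to that space. With
    E an antiderivative of e, all boundary terms vanish and
      |e|^2 = - <E, e'> = - <E - r, e'> <= |E - r| |g|
    for every r in that space. If |E - r| <= h |E'| = h |e| for some r, then
    |e| <= h |g|. The induction starts with piecewise constants, where the
    Cauchy-Schwarz inequality on each cell gives the constant h. A general
    element of H^1 is first replaced by its absolutely continuous
    representative, by the lemma of du Bois-Reymond. *)

Require Import Defs.
From HB Require Import structures.
From mathcomp Require Import all_boot all_order all_algebra.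
From mathcomp Require Import all_classical all_reals all_analysis.
From mathcomp Require Import measurable_realfun.
From mathcomp Require Import ring lra.

Set Implicit Arguments.
Unset Strict Implicit.
Unset Printing Implicit Defensive.

Import Order.TTheory GRing.Theory Num.Theory.
Import numFieldNormedType.Exports.

Local Open Scope classical_set_scope.
Local Open Scope ring_scope.

(** * Integrals over segments *)

Section itv_integral.
Context {R : realType}.
Implicit Types (a b c d x y : R) (f g e : R -> R).
Notation mu := (@lebesgue_measure R).

Definition itg a b f := mu.-integrable `[a, b] (EFin \o f).

(** For [x < a] the segment is empty, so the value is [0] and not the negative of the reversed
    integral. *)
Definition prim a f x : R := \int[mu]_(t in `[a, x]) f t.

Lemma itgS a b c d f : a <= c -> d <= b -> itg a b f -> itg c d f.
Proof.
move=> ac db; apply: integrableS => //; apply: subset_itv; rewrite bnd_simp//.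
Qed.

Lemma itg_meas a b f : itg a b f -> measurable_fun `[a, b] f.
Proof. by move=> /integrableP[/measurable_EFinP]. Qed.

Lemma itgD a b f g : itg a b f -> itg a b g -> itg a b (fun x => f x + g x).
Proof.
by move=> If Ig; apply: (@integrableD _ _ _ mu _ (measurable_itv _) _ _ If Ig).
Qed.

Lemma itgB a b f g : itg a b f -> itg a b g -> itg a b (fun x => f x - g x).
Proof.
by move=> If Ig; apply: (@integrableB _ _ _ mu _ (measurable_itv _) _ _ If Ig).
Qed.

Lemma itgZ a b (k : R) f : itg a b f -> itg a b (fun x => k * f x).
Proof. by move=> If; apply: (@integrableZl _ _ _ mu _ (measurable_itv _) k _ If). Qed.

Lemma itg_norm a b f : itg a b f -> itg a b (fun x => `|f x|).
Proof. by move=> /integrable_norm. Qed.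

Lemma itg_le a b f g : measurable_fun `[a, b] f -> itg a b g ->
  (forall x, a <= x <= b -> `|f x| <= g x) -> itg a b f.
Proof.
move=> mf ig fg; apply: le_integrable ig => //; first exact/measurable_EFinP.
move=> x; rewrite /= in_itv/= => /fg h; rewrite lee_fin.
by apply: le_trans h _; rewrite ler_norm.
Qed.

Lemma itg_cst a b (k : R) : itg a b (fun=> k).
Proof.
apply: measurable_bounded_integrable => //.
- by rewrite /= lebesgue_measure_itv; case: ifP => _; rewrite ltry.
- exact: bounded_cst.
Qed.

Lemma itg_bounded a b f (M : R) : measurable_fun `[a, b] f ->
  (forall x, a <= x <= b -> `|f x| <= M) -> itg a b f.
Proof. by move=> mf fM; apply: itg_le mf (itg_cst a b M) fM. Qed.

Lemma itg_cts a b f : {within `[a, b], continuous f} -> itg a b f.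
Proof. by apply: continuous_compact_integrable => //; exact: segment_compact. Qed.

Lemma itg_mulb a b f g (M : R) : measurable_fun `[a, b] f ->
  (forall x, a <= x <= b -> `|f x| <= M) -> itg a b g ->
  itg a b (fun x => f x * g x).
Proof.
move=> mf fM ig; apply: (@itg_le _ _ _ (fun x => M * `|g x|)).
- by apply: measurable_funM => //; exact: itg_meas ig.
- exact/itgZ/itg_norm.
- by move=> x /fM fx; rewrite normrM ler_wpM2r.
Qed.

Lemma cts_bounded a b f : {within `[a, b], continuous f} ->
  exists2 M, 0 <= M & forall x, a <= x <= b -> `|f x| <= M.
Proof.
move=> cf; have [ab|ba] := leP a b; last first.
  exists 0 => // x /andP[ax xb]; move: (le_trans ax xb); lra.
have cf' : {within `[a, b], continuous (fun x => `|f x|)}.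
  by move=> x; apply: (continuous_comp (cf x)); exact: norm_continuous.
have [c _ hc] := EVT_max ab cf'; exists `|f c| => // x xab; exact: hc.
Qed.

Lemma eq_itg a b f g : (forall x, a <= x <= b -> f x = g x) ->
  itg a b f -> itg a b g.
Proof.
move=> fg; apply: eq_integrable => // x; rewrite inE /= in_itv /= => /fg ->//.
Qed.

Lemma primD a b f g : itg a b f -> itg a b g ->
  prim a (fun x => f x + g x) b = prim a f b + prim a g b.
Proof. by move=> If Ig; rewrite /prim RintegralD. Qed.

Lemma primB a b f g : itg a b f -> itg a b g ->
  prim a (fun x => f x - g x) b = prim a f b - prim a g b.
Proof. by move=> If Ig; rewrite /prim RintegralB. Qed.

Lemma primZ a b (k : R) f : itg a b f ->
  prim a (fun x => k * f x) b = k * prim a f b.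
Proof. by move=> If; rewrite /prim RintegralZl. Qed.

Lemma prim_cst a b (k : R) : a <= b -> prim a (fun=> k) b = k * (b - a).
Proof.
move=> ab; rewrite /prim Rintegral_cst//= lebesgue_measure_itv /= lte_fin.
by move: ab; rewrite le_eqVlt => /predU1P[->|->//]; rewrite ltxx subrr.
Qed.

Lemma prim_le a b f g : itg a b f -> itg a b g ->
  (forall x, a <= x <= b -> f x <= g x) -> prim a f b <= prim a g b.
Proof.
move=> If Ig fg; apply: le_Rintegral => // x; rewrite /= in_itv /=; exact: fg.
Qed.

Lemma prim_ge0 a b f : (forall x, a <= x <= b -> 0 <= f x) -> 0 <= prim a f b.
Proof. by move=> f0; apply: Rintegral_ge0 => x; rewrite /= in_itv; exact: f0. Qed.

Lemma eq_prim a b f g : (forall x, a <= x <= b -> f x = g x) ->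
  prim a f b = prim a g b.
Proof. by move=> fg; apply: eq_Rintegral => x; rewrite inE/= in_itv /=; exact: fg. Qed.

Lemma prim_norm a b f : itg a b f -> `|prim a f b| <= prim a (fun x => `|f x|) b.
Proof. by move=> If; apply: le_normr_Rintegral. Qed.

Lemma primaa a f : prim a f a = 0.
Proof. by rewrite /prim set_itv1 Rintegral_set1. Qed.

Lemma prim_split a x y f : a <= x -> x <= y -> itg a y f ->
  prim a f y = prim a f x + prim x f y.
Proof.
move=> ax xy If; apply/eqP; rewrite addrC -subr_eq; apply/eqP.
have /= -> := @Rintegral_itvB _ f (BLeft a) (BRight y) x If; rewrite ?bnd_simp//.
apply: Rintegral_itv_obnd_cbnd; apply: integrableS If => //.
by apply: subset_itv; rewrite bnd_simp.
Qed.

Lemma prim_cts a b f : itg a b f -> {within `[a, b], continuous (prim a f)}.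
Proof.
move=> If; have [ab|ba] := leP a b.
  exact: (parameterized_integral_continuous ab If).
have -> : `[a, b]%classic = set0 by rewrite set_itv_ge// bnd_simp -ltNge.
by move=> x; exact: continuous_subspace0.
Qed.

(* In [n] equal steps the increments of [H] add up to at most
   [(b - a) * (G b - G a) / n]; no regularity of [G] is needed. *)
Lemma increment_eq0 a b (H G : R -> R) : a <= b ->
  (forall x y, a <= x -> x <= y -> y <= b ->
    `|H y - H x| <= (y - x) * (G y - G x)) -> H b = H a.
Proof.
move=> ab HG.
have step n : `|H b - H a| <= (b - a) * (G b - G a) / n.+1%:R.
  pose t (i : nat) : R := a + (b - a) * i%:R / n.+1%:R.
  have n0 : n.+1%:R != 0 :> R by rewrite pnatr_eq0.
  have tS i : t i.+1 - t i = (b - a) / n.+1%:R.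
    by rewrite /t -(natr1 i); move: (n.+1%:R) n0 => N N0; field.
  have ta : t 0%N = a by rewrite /t mulr0 mul0r addr0.
  have tb : t n.+1 = b by rewrite /t mulfK// addrC subrK.
  have d0 : 0 <= (b - a) / n.+1%:R by rewrite divr_ge0 ?subr_ge0// ltW.
  have tm i j : (i <= j)%N -> t i <= t j.
    move=> /subnK <-; elim: (j - i)%N => [|k ih]; first by rewrite add0n.
    by rewrite addSn; apply: (le_trans ih); rewrite -subr_ge0 tS.
  have: forall k, (k <= n.+1)%N ->
    `|H (t k) - H a| <= (b - a) / n.+1%:R * (G (t k) - G a).
    elim=> [_|k ih kn]; first by rewrite ta !subrr normr0 mulr0.
    have {}ih := ih (ltnW kn).
    have hk : `|H (t k.+1) - H (t k)| <= (t k.+1 - t k) * (G (t k.+1) - G (t k)).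
      apply: HG; rewrite -?[X in X <= _]ta -?[X in _ <= X]tb ?tm//.
    rewrite tS in hk.
    have -> : H (t k.+1) - H a = (H (t k.+1) - H (t k)) + (H (t k) - H a) by ring.
    apply: le_trans (ler_normD _ _) _.
    by apply: le_trans (lerD hk ih) _; rewrite -mulrDr addrA subrK.
  by move=> /(_ n.+1 (leqnn _)); rewrite tb mulrAC.
apply/eqP; rewrite -subr_eq0 -normr_eq0 eq_le normr_ge0 andbT.
apply/ler_addgt0Pl => eps eps0; rewrite addr0.
set K := (b - a) * (G b - G a) in step.
have K0 : 0 <= K by have := step 0%N; rewrite divr1; apply: le_trans.
(* The number of steps, [truncn (K / eps)] plus one, exceeds [K / eps], so the bound is at most
   [eps]. *)
apply: le_trans (step (Num.truncn (K / eps))) _.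
rewrite ler_pdivrMr ?ltr0n// mulrC -ler_pdivrMr//.
exact/ltW/truncnS_gt.
Qed.

(* As [g] is only integrable, [prim a g] need not be differentiable everywhere:
   instead, from [b = x] to [b = y], the difference of the two sides varies by
   at most [2 M (y - x)] times the integral of [|g|] between [x] and [y]. *)
Lemma prim_by_parts a b e g (c M : R) : a <= b -> itg a b e -> itg a b g ->
  (forall x, a <= x <= b -> `|e x| <= M) ->
  prim a (fun t => prim a e t * g t) b =
  prim a e b * (c + prim a g b) - prim a (fun t => e t * (c + prim a g t)) b.
Proof.
move=> ab Ie Ig eM.
have M0 : 0 <= M by apply: le_trans (eM a _) => //; rewrite lexx ab.
pose u t := c + prim a g t; pose E := prim a e.
have cE : {within `[a, b], continuous E} by exact: prim_cts.
have cu : {within `[a, b], continuous u}.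
  move=> x; apply: (@continuousD _ _ _ (fun=> c : R^o)); first exact: cst_continuous.
  exact: prim_cts.
have [ME _ hME] := cts_bounded cE.
have [Mu _ hMu] := cts_bounded cu.
have mE := itg_meas (itg_cts cE); have mu' := itg_meas (itg_cts cu).
have IEg : itg a b (fun t => E t * g t) by exact: (@itg_mulb _ _ _ _ ME).
have Iue : itg a b (fun t => u t * e t) by exact: (@itg_mulb _ _ _ _ Mu).
have Ieu : itg a b (fun t => e t * u t).
  by apply: eq_itg Iue => x _; rewrite mulrC.
pose H x := prim a (fun t => E t * g t) x + prim a (fun t => e t * u t) x - E x * u x.
suff : H b = H a.
  rewrite /H !primaa /E primaa mul0r; rewrite -/E /u; lra.
apply: (@increment_eq0 _ _ _ (fun x => 2 * M * prim a (fun t => `|g t|) x)) => //.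
move=> x y ax xy yb; have xb := le_trans xy yb; have ay := le_trans ax xy.
have Ux : itg x y g by apply: itgS Ig.
have Ex : itg x y e by apply: itgS Ie.
have split f : itg a b f -> prim a f y = prim a f x + prim x f y.
  by move=> If; apply: prim_split => //; apply: itgS If.
pose D := prim x (fun t => `|g t|) y.
have D0 : 0 <= D by apply: prim_ge0.
(* Freezing [E] at the left end and [u] at the right end absorbs the increment of [E * u] exactly;
   each remaining integral is at most [M * (y - x) * D]. *)
have -> : H y - H x = prim x (fun t => (E t - E x) * g t) y
                    + prim x (fun t => e t * (u t - u y)) y.
  have -> : prim x (fun t => (E t - E x) * g t) y =
    prim x (fun t => E t * g t) y - E x * prim x g y.
    rewrite -primZ// -primB; first by apply: eq_prim => t _; ring.
      by apply: itgS IEg.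
    exact: itgZ.
  have -> : prim x (fun t => e t * (u t - u y)) y =
    prim x (fun t => e t * u t) y - u y * prim x e y.
    rewrite -primZ// -primB; first by apply: eq_prim => t _; ring.
      by apply: itgS Ieu.
    exact: itgZ.
  have EE : E y = E x + prim x e y by exact: split.
  have uu : u y = u x + prim x g y by rewrite /u split// addrA.
  by rewrite /H !split// EE uu; ring.
have -> : (y - x) * (2 * M * prim a (fun t => `|g t|) y -
                     2 * M * prim a (fun t => `|g t|) x)
   = (M * (y - x)) * D + (M * (y - x)) * D.
  by rewrite split ?/D; [ring|exact: itg_norm].
have mS f : measurable_fun `[a, b] f -> measurable_fun `[x, y] f.
  by apply: measurable_funS => //; apply: subset_itv; rewrite bnd_simp.
have sub t : x <= t <= y -> a <= t <= b.
  by move=> /andP[xt ty]; rewrite (le_trans ax xt) (le_trans ty yb).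
have hE t : x <= t <= y -> `|E t - E x| <= M * (y - x).
  move=> /[dup] /sub tab /andP[xt ty].
  have It : itg x t e by apply: itgS Ex.
  rewrite [E t](@prim_split a x t)//; last by apply: itgS Ie => //; case/andP: tab.
  rewrite addrAC subrr add0r; apply: (le_trans (prim_norm It)).
  apply: (@le_trans _ _ (prim x (fun=> M) t)).
    apply: prim_le => //; [exact: itg_norm|exact: itg_cst|].
    by move=> s /andP[xs st]; apply/eM/sub; rewrite xs (le_trans st ty).
  by rewrite prim_cst//; apply: ler_wpM2l => //; rewrite lerD2r.
have hu t : x <= t <= y -> `|u t - u y| <= D.
  move=> /[dup] /sub /andP[at_ tb] /andP[xt ty].
  rewrite /u (@prim_split a t y)//; last by apply: itgS Ig.
  rewrite (_ : _ - _ = - prim t g y); last by ring.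
  have It : itg t y g by apply: itgS Ig.
  rewrite normrN; apply: (le_trans (prim_norm It)).
  rewrite /D (@prim_split x t y)//; last exact: itg_norm.
  by rewrite lerDr; apply: prim_ge0.
have I1 : itg x y (fun t => (E t - E x) * g t).
  apply: (@itg_mulb _ _ _ _ (M * (y - x))) => //.
  by apply: measurable_funB => //; exact: mS.
have I2 : itg x y (fun t => e t * (u t - u y)).
  apply: (@eq_itg _ _ (fun t => (u t - u y) * e t)) => [t _|]; first exact: mulrC.
  by apply: (@itg_mulb _ _ _ _ D) => //; apply: measurable_funB => //; exact: mS.
apply: (le_trans (ler_normD _ _)); apply: lerD.
- apply: (le_trans (prim_norm I1)).
  rewrite /D -primZ; last exact: itg_norm.
  apply: prim_le; [exact: itg_norm|exact/itgZ/itg_norm|].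
  by move=> t /hE ht; rewrite normrM ler_wpM2r.
- apply: (le_trans (prim_norm I2)).
  rewrite (_ : M * _ * D = prim x (fun=> M * D) y); last by rewrite prim_cst//; ring.
  apply: prim_le; [exact: itg_norm|exact: itg_cst|].
  move=> t /[dup] /hu ht /sub /eM et; rewrite normrM.
  by apply: ler_pM.
Qed.

End itv_integral.

(** * Square-integrable functions and orthogonal projection *)

Section inner_product.
Context {R : realType}.
Implicit Types (a b c d x y : R) (f g e s t : R -> R) (l : seq (R -> R)).
Notation mu := (@lebesgue_measure R).

(** Measurability of [f] is required separately, as it does not follow from that of the square. *)
Definition sqi a b f :=
  measurable_fun `[a, b] f /\ itg a b (fun x => f x ^+ 2).

Definition ip a b f g : R := prim a (fun x => f x * g x) b.

Lemma sqiM a b f g : sqi a b f -> sqi a b g -> itg a b (fun x => f x * g x).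
Proof.
move=> [mf If] [mg Ig].
apply: (@itg_le _ _ _ _ (fun x => f x ^+ 2 + g x ^+ 2)).
- exact: measurable_funM.
- exact: itgD.
- move=> x _; rewrite normrM -(real_normK (num_real (f x))).
  rewrite -(real_normK (num_real (g x))).
  have := sqr_ge0 (`|f x| - `|g x|); have : 0 <= `|f x| * `|g x| by [].
  by rewrite sqrrB; lra.
Qed.

Lemma sqiZ a b k f : sqi a b f -> sqi a b (fun x => k * f x).
Proof.
move=> [mf If]; split; first by apply: measurable_funM.
by apply: eq_itg (itgZ (k ^+ 2) If) => x _; rewrite exprMn.
Qed.

Lemma sqiD a b f g : sqi a b f -> sqi a b g -> sqi a b (fun x => f x + g x).
Proof.
move=> sf sg; have Ifg := sqiM sf sg; case: sf sg => [mf If] [mg Ig].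
split; first exact: measurable_funD.
by apply: eq_itg (itgD (itgD If Ig) (itgZ 2 Ifg)) => x _; ring.
Qed.

Lemma sqiB a b f g : sqi a b f -> sqi a b g -> sqi a b (fun x => f x - g x).
Proof.
move=> sf sg; suff -> : (fun x => f x - g x) = (fun x => f x + -1 * g x).
  exact/sqiD/sqiZ.
by apply/funext => x; rewrite mulN1r.
Qed.

Lemma sqi_bounded a b f M : measurable_fun `[a, b] f ->
  (forall x, a <= x <= b -> `|f x| <= M) -> sqi a b f.
Proof.
move=> mf fM; split => //; apply: (@itg_bounded _ _ _ _ (M ^+ 2)).
  exact: measurable_funX.
move=> x /fM; rewrite normrX => fx; apply: lerXn2r; rewrite ?nnegrE//.
by apply: le_trans fx.
Qed.

Lemma sqi_cts a b f : {within `[a, b], continuous f} -> sqi a b f.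
Proof.
move=> cf; have [M _ fM] := cts_bounded cf.
by apply: sqi_bounded fM; apply: itg_meas; exact: itg_cts.
Qed.

Lemma sqi_cst a b k : sqi a b (fun=> k).
Proof. by apply: (@sqi_bounded _ _ _ `|k|). Qed.

Lemma sqi_itg a b f : sqi a b f -> itg a b f.
Proof.
move=> sf; apply: eq_itg (sqiM sf (sqi_cst a b 1)) => x _; exact: mulr1.
Qed.

Lemma sqiS a b c d f : a <= c -> d <= b -> sqi a b f -> sqi c d f.
Proof.
move=> ac db [mf If]; split; last by apply: itgS If.
by apply: measurable_funS mf => //; apply: subset_itv; rewrite bnd_simp.
Qed.

Lemma ipC a b f g : ip a b f g = ip a b g f.
Proof. by apply: eq_prim => x _; rewrite mulrC. Qed.

Lemma ipDl a b f g e : sqi a b f -> sqi a b g -> sqi a b e ->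
  ip a b (fun x => f x + g x) e = ip a b f e + ip a b g e.
Proof.
move=> sf sg se; rewrite /ip -primD; [|exact: sqiM|exact: sqiM].
by apply: eq_prim => x _; rewrite mulrDl.
Qed.

Lemma ipZl a b k f e : sqi a b f -> sqi a b e ->
  ip a b (fun x => k * f x) e = k * ip a b f e.
Proof.
move=> sf se; rewrite /ip -primZ; last exact: sqiM.
by apply: eq_prim => x _; rewrite mulrA.
Qed.

Lemma ipBl a b f g e : sqi a b f -> sqi a b g -> sqi a b e ->
  ip a b (fun x => f x - g x) e = ip a b f e - ip a b g e.
Proof.
move=> sf sg se; rewrite /ip -primB; [|exact: sqiM|exact: sqiM].
by apply: eq_prim => x _; rewrite mulrBl.
Qed.

Lemma ip_ge0 a b f : 0 <= ip a b f f.
Proof. by apply: prim_ge0 => x _; exact: sqr_ge0. Qed.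

Lemma ip_sqB a b f g k : sqi a b f -> sqi a b g ->
  ip a b (fun x => f x - k * g x) (fun x => f x - k * g x) =
  ip a b f f - 2 * k * ip a b f g + k ^+ 2 * ip a b g g.
Proof.
move=> sf sg; have skg := sqiZ k sg.
have sd : sqi a b (fun x => f x - k * g x) by exact: sqiB.
have E e : sqi a b e -> ip a b e (fun x => f x - k * g x) =
    ip a b e f - k * ip a b e g.
  by move=> se; rewrite ipC ipBl// ipZl// [ip a b f e]ipC [ip a b g e]ipC.
by rewrite ipBl// ipZl// !E// [ip a b g f]ipC; ring.
Qed.

(** The squared norm of [f - k g] is a nonnegative polynomial in [k] of degree at most two. *)
Lemma cauchy_schwarz a b f g : sqi a b f -> sqi a b g ->
  ip a b f g ^+ 2 <= ip a b f f * ip a b g g.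
Proof.
move=> sf sg.
have H k : 0 <= ip a b f f - 2 * k * ip a b f g + k ^+ 2 * ip a b g g.
  by rewrite -ip_sqB// ip_ge0.
move: (ip_ge0 a b f) (ip_ge0 a b g) H.
move: (ip a b f f) (ip a b f g) (ip a b g g) => A B C A0.
rewrite le_eqVlt => /predU1P[<-|C0] H.
  rewrite mulr0; have [->|B0] := eqVneq B 0; first by rewrite expr0n.
  (* Here [g] has norm zero and the polynomial is affine in [k]; this [k] would give it the value
     [-1]. *)
  have := H ((A + 1) / (2 * B)); rewrite mulr0 addr0.
  rewrite (_ : 2 * _ * B = A + 1); first lra.
  by field.
(* The minimizer of the polynomial. *)
have := H (B / C).
rewrite (_ : A - _ + _ = (A * C - B ^+ 2) / C); last by field; lra.
by rewrite pmulr_lge0 ?invr_gt0// subr_ge0.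
Qed.

(** The linear span of a finite list, with equality of functions on all of [R]; the recursion on the
    list is the one of Gram-Schmidt in [projection]. *)
Fixpoint lin l f : Prop :=
  if l is s :: l' then exists k g, lin l' g /\ f = (fun x => k * s x + g x)
  else f = fun=> 0.

Lemma linD l f g : lin l f -> lin l g -> lin l (fun x => f x + g x).
Proof.
elim: l f g => /= [f g -> ->|s l ih f g [k [f' [lf ->]]] [m [g' [lg ->]]]].
  by apply/funext => x; rewrite addr0.
exists (k + m), (fun x => f' x + g' x); split; first exact: ih.
by apply/funext => x; ring.
Qed.

Lemma linZ l k f : lin l f -> lin l (fun x => k * f x).
Proof.
elim: l f => /= [f ->|s l ih f [m [f' [lf ->]]]].
  by apply/funext => x; rewrite mulr0.
exists (k * m), (fun x => k * f' x); split; first exact: ih.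
by apply/funext => x; ring.
Qed.

Lemma lin_ind (P : (R -> R) -> Prop) l : P (fun=> 0) ->
  (forall k s g, P s -> P g -> P (fun x => k * s x + g x)) ->
  (forall s, List.In s l -> P s) -> forall f, lin l f -> P f.
Proof.
move=> P0 PD; elim: l => [_ f ->//|s l ih Pl f [k [g [lg ->]]]].
apply: PD; first by apply: Pl; left.
by apply: ih lg => s' s'l; apply: Pl; right.
Qed.

(** Gram-Schmidt, one generator at a time: project both [f] and the new generator [s0] onto the span
    of the others, then remove from the residual [v] of [f] its component along the residual [r] of
    [s0]. The generators may be linearly dependent. *)
Lemma projection a b l f : (forall s, List.In s l -> sqi a b s) -> sqi a b f ->
  exists2 s, lin l s & forall t, lin l t -> ip a b (fun x => f x - s x) t = 0.
Proof.
have sql l' : (forall s, List.In s l' -> sqi a b s) ->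
    forall s, lin l' s -> sqi a b s.
  move=> sl; apply: lin_ind sl; first exact: sqi_cst.
  by move=> k s g ss sg; apply: sqiD => //; exact: sqiZ.
elim: l f => [|s0 l ih] f sl sf.
  exists (fun=> 0) => // t ->; rewrite /ip.
  rewrite (@eq_prim _ _ _ _ (fun=> 0 * 0)); last by move=> x _; rewrite mulr0 mul0r.
  by rewrite mulr0 /prim Rintegral_cst//= mul0r.
have sl' s : List.In s l -> sqi a b s by move=> sl0; apply: sl; right.
have ss0 : sqi a b s0 by apply: sl; left.
have [f1 lf1 pf1] := ih _ sl' sf.
have [s1 ls1 ps1] := ih _ sl' ss0.
have sf1 := sql _ sl' _ lf1; have ss1 := sql _ sl' _ ls1.
pose r x := s0 x - s1 x; pose v x := f x - f1 x.
have sr : sqi a b r by exact: sqiB.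
have sv : sqi a b v by exact: sqiB.
pose k := ip a b v r / ip a b r r.
have kr : k * ip a b r r = ip a b v r.
  (* if [ip r r = 0] then [k = _ / 0 = 0], and [ip v r = 0] by Cauchy-Schwarz *)
  rewrite /k; have [r0|r0] := eqVneq (ip a b r r) 0; last by rewrite divfK.
  have := cauchy_schwarz sv sr; rewrite r0 mulr0 => h.
  rewrite mulr0; apply/esym/eqP; rewrite -sqrf_eq0 eq_le h; exact: sqr_ge0.
(* This is [f1 + k r], written as a member of the span. *)
exists (fun x => k * s0 x + (f1 x + - k * s1 x)) => /=.
  exists k, (fun x => f1 x + - k * s1 x); split => //.
  by apply: linD => //; exact: linZ.
have -> : (fun x => f x - (k * s0 x + (f1 x + - k * s1 x))) = (fun x => v x - k * r x).
  by apply/funext => x; rewrite /v /r; ring.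
have ort t : lin l t -> ip a b (fun x => v x - k * r x) t = 0.
  move=> lt; have st := sql _ sl' _ lt.
  by rewrite ipBl ?ipZl ?pf1 ?ps1// ?mulr0 ?subr0//; exact: sqiZ.
have sd : sqi a b (fun x => v x - k * r x) by apply: sqiB => //; exact: sqiZ.
move=> t /= [m [g [lg ->]]].
have sg := sql _ sl' _ lg.
have ortr : ip a b (fun x => v x - k * r x) r = 0.
  by rewrite ipBl ?ipZl// ?kr ?subrr//; exact: sqiZ.
rewrite ipC ipDl ?ipZl//; last exact: sqiZ.
rewrite [ip a b g _]ipC ort// addr0.
have -> : s0 = (fun x => r x + s1 x) by apply/funext => x; rewrite /r subrK.
by rewrite ipDl// [ip a b s1 _]ipC ort// addr0 ipC ortr mulr0.
Qed.

End inner_product.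

(** * Spline spaces *)

Section spline_space.
Context {R : realType} (a h : R) (n : nat) (h0 : 0 < h).
Implicit Types (b c d x y : R) (f g e s t : R -> R) (par : bool) (p : nat).
Notation mu := (@lebesgue_measure R).

Definition knot (j : nat) : R := a + h * j%:R.
Local Notation b := (knot n).

(* [par = true]: odd derivatives vanish at both ends; [par = false]: even ones
   do. Derivatives of order [p] and more are unconstrained. Piecewise constants
   are written with jumps at the knots; the one at the last knot is irrelevant
   on the interval and only simplifies the bookkeeping. *)
Fixpoint spl par p s : Prop :=
  match p with
  | 0 => exists c (d : nat -> R),
      s = (fun x => c + \sum_(j < n) d j * (knot j.+1 < x)%R%:R)
  | p'.+1 => exists c t, [/\ spl (~~ par) p' t, s = (fun x => c + prim a t x) &
      ~~ par -> c = 0 /\ prim a t b = 0]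
  end.

Lemma knot0 : knot 0 = a.
Proof. by rewrite /knot mulr0 addr0. Qed.

Lemma knotS j : knot j.+1 = knot j + h.
Proof. by rewrite /knot -natr1; ring. Qed.

Lemma knot_le i j : (knot i <= knot j) = (i <= j)%N.
Proof. by rewrite /knot lerD2l ler_pM2l// ler_nat. Qed.

Lemma knot_lt i j : (knot i < knot j) = (i < j)%N.
Proof. by rewrite /knot ltrD2l ltr_pM2l// ltr_nat. Qed.

Lemma le_ab : a <= b.
Proof. by rewrite -[X in X <= _]knot0 knot_le. Qed.

Lemma spl0_itg c (d : nat -> R) y :
  itg a y (fun x => c + \sum_(j < n) d j * (knot j.+1 < x)%R%:R).
Proof.
apply: (@itg_bounded _ _ _ _ (`|c| + \sum_(j < n) `|d j|)).
  apply: measurable_funD => //; apply: measurable_sum => i.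
  apply: measurable_funM => //.
  have -> : (fun x => (knot i.+1 < x)%R%:R) = \1_(`]knot i.+1, +oo[%classic) :> (R -> R).
    by apply/funext => x; rewrite indicE mem_setE in_itv/= andbT.
  exact: measurable_indic.
move=> x _; apply: le_trans (ler_normD _ _) _; rewrite lerD2l.
apply: le_trans (ler_norm_sum _ _ _) _; apply: ler_sum => i _.
by rewrite normrM normr_nat ler_piMr//; case: ltP.
Qed.

(** The end point [y] is arbitrary, possibly beyond the last knot, because splines are compared as
    functions on the whole line. *)
Lemma spl_itg par p s : spl par p s -> forall y, itg a y s.
Proof.
elim: p par s => [|p ih] par s /=; first by move=> [c [d ->]] y; exact: spl0_itg.
move=> [c [t [st -> _]]] y; apply: itgD; first exact: itg_cst.
exact/itg_cts/prim_cts/(ih _ _ st).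
Qed.

Lemma spl_sqi par p s : spl par p s -> sqi a b s.
Proof.
case: p => [|p] /=.
  move=> [c [d ->]]; set f := fun _ => _.
  apply: (@sqi_bounded _ _ _ _ (`|c| + \sum_(j < n) `|d j|)).
    by apply: itg_meas; exact: spl0_itg.
  move=> x _; apply: le_trans (ler_normD _ _) _; rewrite lerD2l.
  apply: le_trans (ler_norm_sum _ _ _) _; apply: ler_sum => i _.
  by rewrite normrM normr_nat ler_piMr//; case: ltP.
move=> [c [t [st -> _]]]; apply: sqiD; first exact: sqi_cst.
exact/sqi_cts/prim_cts/(spl_itg st).
Qed.

Lemma splD par p s t : spl par p s -> spl par p t ->
  spl par p (fun x => s x + t x).
Proof.
elim: p par s t => [|p ih] par s t /=.
  move=> [c [d ->]] [c' [d' ->]]; exists (c + c'), (fun j => d j + d' j).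
  apply/funext => x; rewrite addrACA -big_split; congr (_ + _).
  by apply: eq_bigr => i _; rewrite mulrDl.
move=> [c [u [su -> hu]]] [c' [v [sv -> hv]]].
exists (c + c'), (fun x => u x + v x); split; first exact: ih.
  apply/funext => x; rewrite addrACA primD//; first exact: spl_itg su _.
  exact: spl_itg sv _.
move=> /[dup] /hu[-> pu] /hv[-> pv]; rewrite addr0 primD ?pu ?pv ?addr0//.
  exact: spl_itg su _.
exact: spl_itg sv _.
Qed.

Lemma splZ par p k s : spl par p s -> spl par p (fun x => k * s x).
Proof.
elim: p par s => [|p ih] par s /=.
  move=> [c [d ->]]; exists (k * c), (fun j => k * d j).
  apply/funext => x; rewrite mulrDr mulr_sumr; congr (_ + _).
  by apply: eq_bigr => i _; rewrite mulrA.
move=> [c [u [su -> hu]]].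
exists (k * c), (fun x => k * u x); split; first exact: ih.
  by apply/funext => x; rewrite mulrDr primZ//; exact: spl_itg su _.
by move=> /hu[-> pu]; rewrite mulr0 primZ ?pu ?mulr0//; exact: spl_itg su _.
Qed.

Lemma spl_zero par p : spl par p (fun=> 0).
Proof.
elim: p par => [|p ih] par /=.
  exists 0, (fun=> 0); apply/funext => x.
  by rewrite big1 ?addr0// => i _; rewrite mul0r.
have P0 y : prim a (fun=> 0 : R) y = 0.
  by rewrite /prim Rintegral_cst//= mul0r.
exists 0, (fun=> 0); split => //.
by apply/funext => x; rewrite P0 addr0.
Qed.

Lemma spl_cst p k : spl true p (fun=> k).
Proof.
case: p => [|p] /=.
  exists k, (fun=> 0); apply/funext => x.
  by rewrite big1 ?addr0// => i _; rewrite mul0r.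
have P0 y : prim a (fun=> 0 : R) y = 0.
  by rewrite /prim Rintegral_cst//= mul0r.
exists k, (fun=> 0); split => //; first exact: spl_zero.
by apply/funext => x; rewrite P0 addr0.
Qed.

(** Integration is linear only on integrable functions, so linearity of [A] is asked only under an
    invariant [P] that is stable under linear combinations. *)
Lemma lin_map (A : (R -> R) -> R -> R) (P : (R -> R) -> Prop) l :
  (forall s, List.In s l -> P s) -> P (fun=> 0) ->
  (forall k s g, P s -> P g -> P (fun x => k * s x + g x)) ->
  A (fun=> 0) = (fun=> 0) ->
  (forall k s g, P s -> P g ->
     A (fun x => k * s x + g x) = (fun x => k * A s x + A g x)) ->
  forall t, lin l t -> lin (map A l) (A t).
Proof.
move=> Pl P0 PD A0 AD; elim: l Pl => /= [_ t ->//|s l ih Pl t [k [g [lg ->]]]].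
have Ps : P s by apply: Pl; left.
have Pl' : forall s', List.In s' l -> P s' by move=> s' sl; apply: Pl; right.
exists k, (A g); split; first exact: ih.
by rewrite AD//; apply: lin_ind lg.
Qed.

Lemma in_map (A : (R -> R) -> R -> R) l s : List.In s (map A l) ->
  exists2 t, List.In t l & s = A t.
Proof.
elim: l => //= t l ih [<-|/ih[u ul ->]]; first by exists t => //; left.
by exists u => //; right.
Qed.

(** Finite generation makes orthogonal projection available. Generators of the next degree are
    antiderivatives of those of the other parity, together with the constant [1] if [par = true]. *)
Lemma spl_fgen par p : exists l, (forall s, List.In s l -> spl par p s) /\
  (forall s, spl par p s -> lin l s).
Proof.
elim: p par => [|p ih] par.
  pose F (j : nat) x : R := (knot j.+1 < x)%R%:R.
  exists ((fun=> 1) :: map F (iota 0 n)); split.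
    move=> s [<-|].
      exists 1, (fun=> 0); apply/funext => x.
      by rewrite big1 ?addr0// => i _; rewrite mul0r.
    have : forall l, {subset l <= iota 0 n} -> List.In s (map F l) -> spl par 0 s.
      elim=> //= i l ihl il [<-|sl]; last first.
        by apply: ihl => // j jl; apply: il; rewrite inE jl orbT.
      have i_n : (i < n)%N by have := il i (mem_head _ _); rewrite mem_iota.
      exists 0, (fun j => (j == i)%:R); apply/funext => x.
      rewrite add0r (bigD1 (Ordinal i_n))//= eqxx mul1r big1 ?addr0// => j ji.
      by rewrite (_ : (_ == _) = false) ?mul0r//; apply/negbTE.
    exact.
  move=> s [c [d ->]]; exists c, (fun x => \sum_(j < n) d j * F j x); split; last first.
    by apply/funext => x; rewrite mulr1.
  under eq_fun do rewrite -(big_mkord xpredT (fun j => d j * F j _)) /index_iota subn0.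
  elim: (iota 0 n) => [|i l ihl] /=; first by apply/funext => x; rewrite big_nil.
  exists (d i), (fun x => \sum_(j <- l) d j * F j x); split => //.
  by apply/funext => x; rewrite big_cons.
have [l [l1 l2]] := ih (~~ par).
have P0 y : prim a (fun=> 0 : R) y = 0.
  by rewrite /prim Rintegral_cst//= mul0r.
pose P (f : R -> R) := forall y, itg a y f.
have Pl s : List.In s l -> P s by move=> /l1 /spl_itg.
have PP0 : P (fun=> 0) by move=> y; exact: itg_cst.
have PD k s g : P s -> P g -> P (fun x => k * s x + g x).
  by move=> Ps Pg y; apply: itgD => //; exact: itgZ.
case: par l1 l2 => l1 l2.
  exists ((fun=> 1) :: map (prim a) l); split.
    move=> s /= [<-|/in_map[t /l1 st ->]].
      exact: (spl_cst p.+1 1).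
    by exists 0, t; split => //; apply/funext => x; rewrite add0r.
  move=> s /= [c [t [/l2 st -> _]]].
  exists c, (prim a t); split; last by apply/funext => x; rewrite mulr1.
  apply: lin_map Pl PP0 PD _ _ _ st.
    by apply/funext => x; exact: P0.
  move=> k u g Pu Pg; apply/funext => x.
  by rewrite primD// ?primZ//; exact: itgZ.
(* The antiderivative of [f] vanishes at [b] only if [f] has mean zero, so [A] first subtracts the
   mean; on functions of mean zero it agrees with [prim a]. The subtraction stays in the space,
   which contains the constants. *)
pose m f := prim a f b / (b - a).
pose A f := prim a (fun x => f x - m f).
have splB t : spl true p t -> spl true p (fun x => t x - m t).
  by move=> st; apply: splD => //; exact: spl_cst.
exists (map A l); split.
  move=> s /in_map[t /l1 st ->]; exists 0, (fun x => t x - m t); split.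
  - exact: splB.
  - by apply/funext => x; rewrite add0r.
  - move=> _; split => //; rewrite primB ?prim_cst ?le_ab//; last 2 first.
    + exact: spl_itg st _.
    + exact: itg_cst.
    (* If [n = 0], the segment is a point and the mean is a division by zero; both terms vanish
       nevertheless. *)
    rewrite /m; have [ab|ab] := eqVneq (b - a) 0; last by rewrite divfK// subrr.
    have /eqP -> : b == a by rewrite -subr_eq0 ab.
    by rewrite primaa subrr mulr0 subr0.
move=> s [c [t [/[dup] st /l2 lt -> /(_ isT)[-> mt]]]].
have -> : (fun x => 0 + prim a t x) = A t.
  apply/funext => x; rewrite /A /m mt mul0r add0r; congr prim.
  by apply/funext => y; rewrite subr0.
have mE k u g : P u -> P g -> m (fun x => k * u x + g x) = k * m u + m g.
  by move=> Pu Pg; rewrite /m primD ?primZ//; [ring|exact: itgZ].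
apply: lin_map Pl PP0 PD _ _ _ lt.
  by apply/funext => x; rewrite /A /m !P0 mul0r; under eq_fun do rewrite subr0; exact: P0.
move=> k u g Pu Pg; apply/funext => x; rewrite /A mE//.
have Pum : P (fun y => u y - m u) by move=> y; apply: itgB => //; exact: itg_cst.
have Pgm : P (fun y => g y - m g) by move=> y; apply: itgB => //; exact: itg_cst.
rewrite -primZ// -primD//; last exact: itgZ.
by apply: eq_prim => y _; ring.
Qed.

Lemma spl_projection par p f : sqi a b f -> exists2 s, spl par p s &
  forall t, spl par p t -> ip a b (fun x => f x - s x) t = 0.
Proof.
have [l [l1 l2]] := spl_fgen par p => sf.
have [|s ls ps] := projection (a := a) (b := b) (l := l) _ sf.
  by move=> s /l1 /spl_sqi.
exists s; last by move=> t /l2; exact: ps.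
apply: lin_ind l1 _ ls; first exact: spl_zero.
by move=> k u g su sg; apply: splD => //; exact: splZ.
Qed.

End spline_space.

(** * The error estimate in the spline spaces of both parities *)

Section approximation.
Context {R : realType} (a h : R) (n : nat) (h0 : 0 < h) (n0 : (0 < n)%N).
Implicit Types (c x y : R) (f g e s : R -> R) (par : bool) (p : nat).
Notation mu := (@lebesgue_measure R).
Local Notation knot := (knot a h).
Local Notation b := (knot n).
Local Notation spl := (spl a h n).

(** On a cell, piecewise constants have a uniform value only off the left knot, so that null set is
    left out of the comparison. *)
Lemma prim_le_o x y f g : itg x y f -> itg x y g ->
  (forall t, x < t <= y -> f t <= g t) -> prim x f y <= prim x g y.
Proof.
move=> If Ig fg.
have IS k : itg x y k -> mu.-integrable `]x, y] (EFin \o k).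
  by apply: integrableS => //; apply: subset_itv; rewrite bnd_simp.
rewrite /prim -(Rintegral_itv_obnd_cbnd (IS _ If)) -(Rintegral_itv_obnd_cbnd (IS _ Ig)).
by apply: le_Rintegral => //; exact: IS.
Qed.

(** To the right of knot [k] and up to the next one, exactly the first [k] jumps have taken
    place. *)
Lemma spl0_val c (d : nat -> R) k x : (k < n)%N -> knot k < x <= knot k.+1 ->
  c + \sum_(j < n) d j * (knot j.+1 < x)%R%:R = c + \sum_(j < k) d j.
Proof.
move=> kn /andP[kx xk]; congr (_ + _).
rewrite (big_ord_widen _ d (ltnW kn)) [RHS]big_mkcond /=; apply: eq_bigr => j _.
have [jk|kj] := ltnP j k; last first.
  rewrite (_ : (_ < _) = false) ?mulr0//; apply/negbTE; rewrite -leNgt.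
  by apply: (le_trans xk); rewrite knot_le.
by rewrite (_ : (_ < _) = true) ?mulr1//; apply: le_lt_trans kx; rewrite knot_le.
Qed.

(** Cauchy-Schwarz against the constant [1]. *)
Lemma prim_sqr x y g : x <= y -> sqi x y g ->
  prim x g y ^+ 2 <= (y - x) * prim x (fun t => g t ^+ 2) y.
Proof.
move=> xy sg; have := cauchy_schwarz sg (sqi_cst x y 1).
rewrite (_ : ip x y g _ = prim x g y); last by apply: eq_prim => t _; rewrite mulr1.
rewrite [X in _ <= _ * X]/ip prim_cst//.
rewrite (_ : ip x y g g = prim x (fun t => g t ^+ 2) y) => [h'|]; last exact: eq_prim.
by apply: le_trans h' _; rewrite !mul1r mulrC.
Qed.

(** The approximant takes on each cell the value of the antiderivative at the left knot. The squared
    error there is at most [h] times the integral of [g ^+ 2] over the cell, and integrating it over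
    the cell gives the second factor [h]. *)
Lemma spl_approx0 par c g : sqi a b g -> exists s, spl par 0 s /\
  ip a b (fun x => c + prim a g x - s x) (fun x => c + prim a g x - s x)
    <= h ^+ 2 * ip a b g g.
Proof.
move=> sg; pose U x := c + prim a g x.
(* The jumps are the increments of [U] between knots, so that their partial sums telescope. *)
pose d (j : nat) := U (knot j.+1) - U (knot j).
pose s x := c + \sum_(j < n) d j * (knot j.+1 < x)%R%:R.
have ss : spl par 0 s by exists c, d.
exists s; split => //.
have Ie : sqi a b (fun x => U x - s x).
  apply: sqiB; last exact: spl_sqi ss.
  apply: sqiD; first exact: sqi_cst.
  exact/sqi_cts/prim_cts/sqi_itg.
have kS i j : (i <= j)%N -> knot i <= knot j by rewrite knot_le.
have ak j : a <= knot j by rewrite -[X in X <= _](knot0 a h) kS.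
suff : forall k, (k <= n)%N -> prim a (fun x => (U x - s x) ^+ 2) (knot k)
    <= h ^+ 2 * prim a (fun x => g x ^+ 2) (knot k) by exact.
elim=> [_|k ih kn]; first by rewrite knot0 !primaa mulr0.
have {}ih := ih (ltnW kn).
have kk : knot k <= knot k.+1 by apply: kS.
have kb : knot k.+1 <= b by exact: kS.
have sgk : sqi (knot k) (knot k.+1) g by apply: sqiS sg.
have Ig2 : itg (knot k) (knot k.+1) (fun x => g x ^+ 2) by case: sgk.
rewrite (@prim_split _ a (knot k)) ?ak//; last by case: Ie => _; apply: itgS.
rewrite [prim a (fun x => g x ^+ 2) _](@prim_split _ a (knot k)) ?ak//; last first.
  by case: sg => _; apply: itgS.
rewrite mulrDr; apply: lerD => //.
pose I := prim (knot k) (fun x => g x ^+ 2) (knot k.+1).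
apply: (@le_trans _ _ (prim (knot k) (fun=> h * I) (knot k.+1))); last first.
  have hk : knot k.+1 - knot k = h by rewrite knotS addrAC subrr add0r.
  by rewrite prim_cst// hk mulrAC -expr2.
apply: prim_le_o; [|exact: itg_cst|].
  by case: Ie => _; apply: itgS.
move=> t /andP[kt tk]; have at_ := le_trans (ak k) (ltW kt).
have sU : s t = U (knot k).
  rewrite /s (spl0_val c d kn) ?kt//.
  rewrite -(big_mkord xpredT d) (telescope_sumr (fun j => U (knot j)))//.
  by rewrite knot0 {2}/U primaa; lra.
have sgt : sqi (knot k) t g by apply: sqiS sgk.
rewrite sU /U (@prim_split _ a (knot k) t) ?ak ?(ltW kt)//; last first.
  by apply: itgS (sqi_itg sg) => //; apply: le_trans kb.
rewrite (_ : _ - _ = prim (knot k) g t); last by ring.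
apply: le_trans (prim_sqr (ltW kt) sgt) _; apply: ler_pM.
- by rewrite subr_ge0 ltW.
- by apply: prim_ge0 => x _; exact: sqr_ge0.
- by rewrite lerBlDl -knotS.
- rewrite /I (@prim_split _ (knot k) t (knot k.+1)) ?(ltW kt)//.
  by rewrite lerDl; apply: prim_ge0 => x _; exact: sqr_ge0.
Qed.

(** The induction step uses the estimate for the other parity, hence both are treated together. The
    condition for [par = false] says that the approximated function vanishes at both ends. *)
Lemma spl_approx par p c g : sqi a b g -> (~~ par -> c = 0 /\ prim a g b = 0) ->
  exists s, spl par p s /\
  ip a b (fun x => c + prim a g x - s x) (fun x => c + prim a g x - s x)
    <= h ^+ 2 * ip a b g g.
Proof.
elim: p par c g => [|p ih] par c g sg hpar; first exact: spl_approx0.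
have [s0 ss0 ps0] := spl_projection h0 (~~ par) p sg.
have qs0 := spl_sqi ss0.
have ab : a < b by rewrite -[X in X < _](knot0 a h) knot_lt.
have Ig := sqi_itg sg; have Is0 := sqi_itg qs0.
pose r x := g x - s0 x.
have sr : sqi a b r by exact: sqiB.
have Ir := sqi_itg sr.
have cprim f k : itg a b f -> {within `[a, b], continuous (fun x => k + prim a f x)}.
  move=> If x; apply: (@continuousD _ _ _ (fun=> k : R^o)); first exact: cst_continuous.
  exact: prim_cts.
have primr k : forall x, a <= x <= b ->
    k + prim a r x = k + prim a g x - prim a s0 x.
  move=> x /andP[ax xb]; rewrite primB ?addrA//.
    by apply: itgS Ig.
  by apply: itgS Is0.
(* The constant [c'] removes the boundary term at [b]: for [par = true] it makes the error [e] have
   mean zero, so that its antiderivative vanishes there; for [par = false] it is [0] and [e] itself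
   vanishes there. *)
have [c' [hc' Eb]] : exists c',
    (~~ par -> c' = 0 /\ prim a s0 b = 0) /\
    (par -> prim a (fun x => (c - c') + prim a r x) b = 0) /\
    (~~ par -> (c - c') + prim a r b = 0).
  case: par hpar ss0 ps0 => hpar ss0 ps0.
    exists (prim a (fun x => c + prim a r x) b / (b - a)); split => //; split => // _.
    set k := _ / _.
    rewrite (@eq_prim _ _ _ _ (fun x => (c + prim a r x) - k)); last first.
      by move=> x _; ring.
    rewrite primB; [|exact/itg_cts/cprim|exact: itg_cst].
    rewrite prim_cst ?ltW// /k divfK ?subrr// subr_eq0.
    by rewrite gt_eqF.
  have [-> g0] := hpar isT.
  (* Constants lie in the space onto which [g] was projected, so [r] is orthogonal to [1]. *)
  have r0 : prim a r b = 0.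
    have := ps0 _ (spl_cst a h n p 1); rewrite /ip => <-.
    by apply: eq_prim => x _; rewrite mulr1.
  exists 0; split; last by split => // _; rewrite r0; ring.
  move=> _; split => //; move: r0; rewrite primB// g0; lra.
pose s x := c' + prim a s0 x.
have ss : spl par p.+1 s by exists c', s0; split.
exists s; split => //.
pose e x := (c - c') + prim a r x.
have ce : {within `[a, b], continuous e} by exact: cprim.
have [M _ eM] := cts_bounded ce.
have se := sqi_cts ce.
have -> : ip a b (fun x => c + prim a g x - s x) (fun x => c + prim a g x - s x)
  = ip a b e e.
  by apply: eq_prim => x xab; rewrite /e (primr _ x xab) /s; ring.
(* The induction hypothesis approximates the antiderivative of the error by [sg'], which lies in the
   same space as [s0]. *)
have [||sg' [ssg hsg]] := ih (~~ par) 0 e => //.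
  by rewrite negbK => /(proj1 Eb).
set w := (fun x => 0 + _ - _) in hsg.
have qsg := spl_sqi ssg.
have sE : sqi a b (prim a e) by exact/sqi_cts/prim_cts/sqi_itg.
have sw : sqi a b w by apply: sqiB => //; apply: sqiD => //; exact: sqi_cst.
(* Orthogonality of [r] to [sg'] turns [w] into the antiderivative of [e]; integration by parts does
   the rest. *)
have key : ip a b e e = - ip a b w r.
  have -> : ip a b w r = ip a b (prim a e) r.
    have -> : w = (fun x => prim a e x - sg' x).
      by apply/funext => x; rewrite /w add0r.
    by rewrite ipBl// [ip a b sg' r]ipC ps0// subr0.
  rewrite /ip (prim_by_parts (c - c') (ltW ab) (sqi_itg se) Ir eM).
  case: (par) Eb => -[E1 E2].
    by rewrite (E1 isT) mul0r sub0r opprK.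
  by rewrite (E2 isT) mulr0 sub0r opprK.
(* Pythagoras: [r] is orthogonal to [s0]. *)
have rr : ip a b r r <= ip a b g g.
  have := ip_sqB 1 sg qs0; have := ps0 _ ss0.
  rewrite ipBl// => p1.
  rewrite (_ : (fun x => g x - 1 * s0 x) = r); last by apply/funext => x; rewrite mul1r.
  move=> ->; have := ip_ge0 a b s0; lra.
have CS := cauchy_schwarz sw sr.
have : ip a b e e ^+ 2 <= (h ^+ 2 * ip a b e e) * ip a b g g.
  rewrite key sqrrN; apply: le_trans CS _; rewrite -key.
  by apply: ler_pM => //; exact: ip_ge0.
(* It remains to divide by [ip a b e e], unless it is zero. *)
have := ip_ge0 a b e; rewrite le_eqVlt => /predU1P[<- _|e0].
  by apply: mulr_ge0; [exact: sqr_ge0|exact: ip_ge0].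
by rewrite expr2 mulrAC ler_pM2r.
Qed.

End approximation.

(** * Test functions and weak derivatives *)

Section test_functions.
Context {R : realType}.
Implicit Types (a b c x y : R) (f g e s t phi : R -> R) (k : nat).
Notation mu := (@lebesgue_measure R).

Lemma Rintegral_oo a b f : a < b -> itg a b f -> \int[mu]_(x in `]a, b[) f x = prim a f b.
Proof.
move=> ab If.
have I1 : mu.-integrable `]a, b[ (EFin \o f).
  by apply: integrableS If => //; apply: subset_itv; rewrite bnd_simp.
have I2 : mu.-integrable `]a, b] (EFin \o f).
  by apply: integrableS If => //; apply: subset_itv; rewrite bnd_simp.
by rewrite (Rintegral_itv_bndo_bndc I1) (Rintegral_itv_obnd_cbnd I2).
Qed.

Lemma derivable_cts f : (forall x, derivable f x 1) -> continuous f.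
Proof. by move=> df x; apply: differentiable_continuous; exact/derivable1_diffP. Qed.

Lemma prim_derive a x f : a <= x -> (forall y, derivable f y 1) ->
  {within `[a, x], continuous (derive1 f)} -> prim a (derive1 f) x = f x - f a.
Proof.
rewrite le_eqVlt => /predU1P[<- _ _|ax df cf']; first by rewrite primaa subrr.
rewrite /prim /Rintegral (@continuous_FTC2 _ _ f)// -?EFinB//.
split=> //.
  by apply: cvg_at_right_filter; exact: (derivable_cts df).
by apply: cvg_at_left_filter; exact: (derivable_cts df).
Qed.

Section test.
Context (a b : R) (phi : R -> R) (ab : a < b) (tphi : test_function `]a, b[ phi).

Lemma test_derivable k x : derivable (derive1n k phi) x 1.
Proof. by case: tphi. Qed.

Lemma test_cts k : continuous (derive1n k phi).
Proof. by apply: derivable_cts; exact: test_derivable. Qed.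

(** The complement of the closed support is open, so near such a point the function is identically
    zero, and so are all its derivatives. *)
Lemma test_out k x : ~ closure [set y | phi y != 0] x -> derive1n k phi x = 0.
Proof.
move=> cx; have: \forall y \near x, ~ closure [set y | phi y != 0] y.
  have : open (~` closure [set y | phi y != 0]) by exact/closed_openC/closed_closure.
  by rewrite openE => /(_ x cx).
elim: k x {cx} => [|k ih] x nx.
  have := nbhs_singleton nx; apply: contra_notP => /= /eqP px.
  exact: subset_closure.
rewrite derive1nS derive1E.
have nx0 : \forall y \near x, derive1n k phi y = cst 0 y.
  by have := near_join nx; apply: filterS => y; exact: ih.
rewrite (near_eq_derive _ nx0) ?derive_cst// oner_neq0//.
Qed.

Lemma test_a k : derive1n k phi a = 0.
Proof.
apply: test_out => /(_ _) ca; case: tphi => _ _ /(_ a ca) /=.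
by rewrite in_itv/= ltxx.
Qed.

Lemma test_b k : derive1n k phi b = 0.
Proof.
apply: test_out => /(_ _) cb; case: tphi => _ _ /(_ b cb) /=.
by rewrite in_itv/= ltxx andbF.
Qed.

Lemma prim_test k x : a <= x -> prim a (derive1n k.+1 phi) x = derive1n k phi x.
Proof.
move=> ax; rewrite derive1nS prim_derive ?test_a ?subr0//.
- exact: test_derivable.
- by rewrite -derive1nS; exact/continuous_subspaceT/test_cts.
Qed.

Lemma test_bounded k : exists2 M, 0 <= M &
  forall x, a <= x <= b -> `|derive1n k phi x| <= M.
Proof. by apply: cts_bounded; exact/continuous_subspaceT/test_cts. Qed.

Lemma test_itgM k f : itg a b f -> itg a b (fun x => f x * derive1n k phi x).
Proof.
move=> If; have [M M0 hM] := test_bounded k.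
apply: (@eq_itg _ _ _ (fun x => derive1n k phi x * f x)) => [x _|]; first exact: mulrC.
apply: itg_mulb hM If; apply: itg_meas; apply: itg_cts.
exact/continuous_subspaceT/test_cts.
Qed.

(** Integration by parts with the derivative of order [k.+1] of [phi] as first factor: its
    antiderivative is the one of order [k], which vanishes at both ends. *)
Lemma int_primM_test c k f : itg a b f ->
  \int[mu]_(x in `]a, b[) ((c + prim a f x) * derive1n k.+1 phi x) =
  - \int[mu]_(x in `]a, b[) (f x * derive1n k phi x).
Proof.
move=> If; have [M M0 hM] := test_bounded k.+1.
have Ie : itg a b (derive1n k.+1 phi).
  exact/itg_cts/continuous_subspaceT/test_cts.
rewrite !Rintegral_oo//; last 2 first.
- exact: test_itgM.
- apply: test_itgM; apply: itgD; first exact: itg_cst.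
  exact/itg_cts/prim_cts.
have := prim_by_parts c (ltW ab) Ie If hM; rewrite prim_test ?ltW// test_b mul0r sub0r.
have -> : prim a (fun x => derive1n k.+1 phi x * (c + prim a f x)) b =
    prim a (fun x => (c + prim a f x) * derive1n k.+1 phi x) b.
  by apply: eq_prim => x _; rewrite mulrC.
move=> h; apply: oppr_inj; rewrite -h opprK.
by apply: eq_prim => x /andP[ax _]; rewrite prim_test// mulrC.
Qed.

End test.

Lemma itg_locally a b f : itg a b f -> locally_integrable `]a, b[ f.
Proof.
move=> If; apply: open_integrable_locally; first exact: interval_open.
by apply: integrableS If => //; apply: subset_itv; rewrite bnd_simp.
Qed.

Lemma weak_deriv0 a b f : itg a b f -> is_weak_deriv `]a, b[ 0 f f.
Proof.
by move=> If; split; [exact: itg_locally|exact: itg_locally|move=> phi _; rewrite mul1r].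
Qed.

Lemma weak_deriv_prim a b c k f g : a < b -> itg a b f ->
  is_weak_deriv `]a, b[ k f g ->
  is_weak_deriv `]a, b[ k.+1 (fun x => c + prim a f x) g.
Proof.
move=> ab If [_ Lg fg]; split => //.
  by apply: itg_locally; apply: itgD; [exact: itg_cst|exact/itg_cts/prim_cts].
by move=> phi tphi; rewrite (int_primM_test ab tphi)// fg// exprS mulN1r mulNr.
Qed.

(** Each derivative undoes one integration in the definition of [spl], which lowers the degree by
    one and switches the parity. *)
Lemma spl_weak_deriv a h (n : nat) par p s k : 0 < h -> (0 < n)%N ->
  spl a h n par p s -> (k <= p)%N ->
  exists2 d, spl a h n (par (+) odd k) (p - k) d &
    is_weak_deriv `]a, knot a h n[ k s d.
Proof.
move=> h0 n0; have ab : a < knot a h n by rewrite -[X in X < _](knot0 a h) knot_lt.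
elim: k par p s => [|k ih] par p s ss kp.
  rewrite subn0 addbF; exists s => //; apply: weak_deriv0; exact: spl_itg ss _.
case: p ss kp => // p [c [t [st -> _]]] kp.
have [d sd wd] := ih _ _ _ st kp.
exists d; first by rewrite subSS /= addbN -addNb.
by apply: weak_deriv_prim => //; exact: spl_itg st _.
Qed.

End test_functions.

(** * Smooth bump functions *)

Section bump.
Context {R : realType}.
Implicit Types (P Q : {poly R}) (x y t : R) (f g : R -> R).
Notation mu := (@lebesgue_measure R).

(* Flat functions [P(1/t) exp(-1/t)]: this family is closed under derivation. *)
Definition sexp P t : R := if 0 < t then P.[t^-1] * expR (- t^-1) else 0.

Lemma poly_bound P : exists2 A, 0 <= A &
  forall y, 1 <= y -> `|P.[y]| <= A * y ^+ size P.
Proof.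
exists (\sum_(i < size P) `|P`_i|) => [|y y1]; first exact: sumr_ge0.
rewrite horner_coef mulr_suml; apply: le_trans (ler_norm_sum _ _ _) _.
apply: ler_sum => i _; rewrite normrM ler_wpM2l// ger0_norm.
  by apply: ler_weXn2l => //; exact: ltnW.
by rewrite exprn_ge0//; apply: le_trans y1.
Qed.

(** With [y = 1/t], the series of the exponential gives [y ^ (m + 1) / (m + 1)! <= exp y], so
    [y ^ m * exp (- y)] is at most [(m + 1)! * t]. *)
Lemma sexp_lin P : exists2 K, 0 <= K & forall t, `|t| <= 1 -> `|sexp P t| <= K * `|t|.
Proof.
have [A A0 hA] := poly_bound P.
pose m := size P.
exists (A * (m.+1)`!%:R) => [|t t1]; first by rewrite mulr_ge0.
rewrite /sexp; case: ltP => t0; last by rewrite normr0 !mulr_ge0.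
rewrite gtr0_norm// in t1 *; rewrite normrM [`|expR _|]gtr0_norm ?expR_gt0//.
have y1 : 1 <= t^-1 by rewrite invf_ge1.
have y0 : 0 < t^-1 by rewrite invr_gt0.
apply: (@le_trans _ _ (A * (t^-1 ^+ m * expR (- t^-1)))).
  by rewrite mulrA ler_wpM2r ?expR_ge0// hA.
rewrite -mulrA ler_wpM2l// expRN.
have E : t^-1 ^+ m.+1 / (m.+1)`!%:R <= expR t^-1.
  by apply: le_trans (expR_ge1Dxn m (ltW y0)); rewrite lerDr.
rewrite ler_pdivrMr ?expR_gt0//.
have f0 : (0 : R) < (m.+1)`!%:R by rewrite ltr0n fact_gt0.
rewrite -mulrA -ler_pdivrMl//; apply: le_trans (ler_wpM2l (ltW t0) E).
rewrite exprS !mulrA divff ?gt_eqF// mul1r mulrC.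
exact: lexx.
Qed.

Lemma sexp_le0 P t : t <= 0 -> sexp P t = 0.
Proof. by rewrite /sexp leNgt => /negbTE ->. Qed.

Lemma sexp_gt0 P t : 0 < t -> sexp P t = P.[t^-1] * expR (- t^-1).
Proof. by rewrite /sexp => ->. Qed.

Lemma sexp_cts0 P : {for 0, continuous (sexp P)}.
Proof.
have [K K0 hK] := sexp_lin P.
suff : sexp P t @[t --> (0 : R)] --> (0 : R).
  by move=> H; rewrite /prop_for /continuous_at (sexp_le0 P (lexx 0)).
apply/cvgrPdist_le => e e0.
have N1 : \forall t \near (0 : R), `|t| <= 1 by exact: nbhs0_le.
have N2 : \forall t \near (0 : R), `|t| <= e / (K + 1).
  by apply: nbhs0_le; rewrite divr_gt0// ltr_wpDl.
apply: filterS2 N1 N2 => t t1 te; rewrite sub0r normrN.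
apply: le_trans (hK _ t1) _.
apply: (@le_trans _ _ ((K + 1) * `|t|)); first by rewrite ler_wpM2r// lerDl.
by rewrite -ler_pdivlMl// ?ltr_wpDl// mulrC.
Qed.

(** Away from [0] this is the chain rule, where the inner derivative of [1/t] produces the factor
    ['X^2]. *)
Lemma sexp_derive P x : is_derive x 1 (sexp P) (sexp ((P - P^`()) * 'X^2) x).
Proof.
have [x0|x0|->] := ltgtP x 0.
- rewrite [X in is_derive _ _ _ X]sexp_le0 ?ltW//.
  apply: (@near_eq_is_derive _ _ _ (cst 0)).
  by near=> t; rewrite sexp_le0//; apply: ltW; near: t; exact: lt_nbhsl.
- rewrite [X in is_derive _ _ _ X]sexp_gt0//.
  apply: (@near_eq_is_derive _ _ _ (fun t => P.[t^-1] * expR (- t^-1))).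
    by near=> t; rewrite sexp_gt0//; near: t; exact: lt_nbhsr.
  have xn0 : id x != 0 by rewrite gt_eqF.
  have dV := is_deriveV xn0 (is_derive_id x 1).
  have dP := is_derive1_comp (is_derive_poly P (x^-1)) dV.
  have dE := @is_derive1_comp _ expR (- GRing.inv) x _ _
    (is_derive_expR (- x^-1)) (is_deriveN dV).
  apply: (is_derive_eq (is_deriveM dP dE)).
  by rewrite /= !hornerE /GRing.scale /= -?exprVn; ring.
- rewrite [X in is_derive _ _ _ X]sexp_le0//; apply/is_derive1_caratheodory.
  (* The difference quotient at [0]: dividing by [t] multiplies the polynomial in [1/t] by ['X]. *)
  exists (sexp (P * 'X)); split.
  + move=> z; rewrite /sexp ltxx !subr0; case: ltP => [z0|]; last by rewrite mul0r.
    rewrite hornerM hornerX; move: (expR _) (P.[_]) => e q.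
    by field; rewrite gt_eqF.
  + exact: sexp_cts0.
  + by rewrite /sexp ltxx.
Unshelve. all: by end_near. Qed.

(** A class closed under derivation, so that smoothness follows by induction on the order. Two flat
    factors with affine arguments allow one for each end of the support. *)
Inductive bump_class : (R -> R) -> Prop :=
| bump_mul P Q (k a b c d : R) :
    bump_class (fun x => k * (sexp P (a * x + b) * sexp Q (c * x + d)))
| bump_add f g : bump_class f -> bump_class g -> bump_class (fun x => f x + g x).

Lemma bump_class_derive f : bump_class f ->
  exists2 g, bump_class g & forall x, is_derive x 1 f (g x).
Proof.
elim=> [P Q k a b c d|f1 f2 _ [g1 c1 d1] _ [g2 c2 d2]]; last first.
  exists (fun x => g1 x + g2 x); first exact: bump_add.
  by move=> x; exact: is_deriveD.
pose P' := (P - P^`()) * 'X^2; pose Q' := (Q - Q^`()) * 'X^2.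
exists (fun x => (k * a) * (sexp P' (a * x + b) * sexp Q (c * x + d)) +
                 (k * c) * (sexp P (a * x + b) * sexp Q' (c * x + d))).
  exact: bump_add (bump_mul _ _ _ _ _ _ _) (bump_mul _ _ _ _ _ _ _).
move=> x.
have aff (u v : R) : is_derive x 1 (fun t : R => u * t + v) u.
  have du := is_deriveZ u (is_derive_id x 1).
  apply: (is_derive_eq (is_deriveD du (is_derive_cst v x 1))).
  by rewrite addr0 /GRing.scale/= mulr1.
have dP : is_derive x 1 (sexp P \o (fun t : R => a * t + b)) (sexp P' (a * x + b) * a).
  by apply: is_derive1_comp; exact: sexp_derive.
have dQ : is_derive x 1 (sexp Q \o (fun t : R => c * t + d)) (sexp Q' (c * x + d) * c).
  by apply: is_derive1_comp; exact: sexp_derive.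
apply: (is_derive_eq (is_deriveZ k (is_deriveM dP dQ))).
by rewrite /GRing.scale /=; ring.
Qed.

Lemma bump_classZ k f : bump_class f -> bump_class (fun x => k * f x).
Proof.
elim=> [P Q m a b c d|f1 f2 _ h1 _ h2].
  by under eq_fun do rewrite mulrA; exact: bump_mul.
by under eq_fun do rewrite mulrDr; exact: bump_add.
Qed.

Lemma bump_class_derivable f k x : bump_class f -> derivable (derive1n k f) x 1.
Proof.
move=> cf; have [g cg dg] : exists2 g, bump_class g &
    forall x, is_derive x 1 (derive1n k f) (g x).
  elim: k => [|k [g cg dg]]; first exact: bump_class_derive.
  have [g' cg' dg'] := bump_class_derive cg; exists g' => //.
  suff -> : derive1n k.+1 f = g by [].
  by apply/funext => y; rewrite derive1nS derive1E derive_val.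
exact: ex_derive.
Qed.

Lemma bump_class_cts f : bump_class f -> continuous f.
Proof. by move=> cf; apply: derivable_cts => x; exact: (@bump_class_derivable f 0). Qed.

(** The antiderivative vanishes to the left of [c], and also to the right of [d] because the total
    integral is zero; so its support is compact in the open interval. *)
Lemma test_prim (a b c d : R) f : a < c -> d < b -> bump_class f ->
  (forall x, f x != 0 -> c <= x <= d) -> a < b -> prim a f b = 0 ->
  test_function `]a, b[ (prim a f) /\ derive1n 1 (prim a f) = f.
Proof.
move=> ac db cf fs ab f0.
have ctf := bump_class_cts cf.
have If y z : itg y z f by exact/itg_cts/continuous_subspaceT.
have fout x : ~~ (c <= x <= d) -> f x = 0.
  by move=> h; apply/eqP; apply: contraNT h; exact: fs.
have P0 x : x < c -> prim a f x = 0.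
  move=> xc; rewrite (@eq_prim _ _ _ _ (fun=> 0)); last first.
    move=> t /andP[_ tx]; apply: fout.
    by rewrite negb_and -ltNge (le_lt_trans tx xc).
  by rewrite /prim Rintegral_cst//= mul0r.
have P1 x : d < x -> prim a f x = 0.
  move=> dx; have I0 y z : d < y -> prim y f z = 0.
    move=> dy; rewrite (@eq_prim _ _ _ _ (fun=> 0)).
      by rewrite /prim Rintegral_cst//= mul0r.
    move=> t /andP[yt _]; apply: fout.
    by rewrite negb_and -!ltNge (lt_le_trans dy yt) orbT.
  have [bx|xb] := leP b x.
    by rewrite (@prim_split _ a b x)// ?(ltW ab)// f0 (I0 b x)// addr0.
  have [ax|xa] := leP a x; last by apply: P0; apply: lt_trans ac.
  by move: f0; rewrite (@prim_split _ a x b)// ?(ltW xb)// (I0 x b)// addr0.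
have D x : is_derive x 1 (prim a f) (f x).
  have [ax|xa] := ltP a x.
    have xx1 : x < x + 1 by rewrite ltrDl.
    have [dF <-] := continuous_FTC1_closed xx1 (If a (x + 1)) ax (ctf x).
    by rewrite derive1E; exact: derivableP.
  have xc := le_lt_trans xa ac.
  rewrite fout ?negb_and -?ltNge ?xc//.
  apply: (@near_eq_is_derive _ _ _ (cst 0)).
  by near=> t; rewrite P0//; near: t; exact: lt_nbhsl.
have E : derive1n 1 (prim a f) = f.
  by apply/funext => x; rewrite derive1n1 derive1E derive_val.
have S : closure [set x | prim a f x != 0] `<=` `[c, d].
  have := @interval_closed R (BLeft c) (BRight d) isT isT.
  move/closure_id => ->; apply: closure_subset => x /= px; rewrite in_itv /=.
  apply/andP; split; rewrite leNgt; apply: contraNN px => xcd; apply/eqP.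
    exact: P0.
  exact: P1.
split=> //; split.
- case=> [|k] x; first exact: ex_derive.
  by rewrite derive1Sn -derive1n1 E; exact: bump_class_derivable.
- by apply: (subclosed_compact _ (@segment_compact R c d) S); exact: closed_closure.
- move=> x /S /=; rewrite !in_itv/= => /andP[cx xd].
  by rewrite (lt_le_trans ac cx) (le_lt_trans xd db).
Unshelve. all: by end_near. Qed.

End bump.

(** * The lemma of du Bois-Reymond *)

Section du_bois_reymond.
Context {R : realType}.
Implicit Types (a b c d x y t : R) (f g v : R -> R) (n : nat).
Notation mu := (@lebesgue_measure R).

(* Since [exp(-1/t)] tends to [1] at infinity, rescaling makes these bumps
   converge boundedly to the indicator function of [(c, d)]. *)
Definition bump c d n x : R :=
  sexp 1 (n.+1%:R * x + (- n.+1%:R * c - 1)) *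
  sexp 1 (- n.+1%:R * x + (n.+1%:R * d - 1)).

Lemma bump_classP c d n : bump_class (bump c d n).
Proof.
have -> : bump c d n = (fun x => 1 * bump c d n x).
  by apply/funext => x; rewrite mul1r.
exact: bump_mul.
Qed.

Lemma sexp1_ge0 t : 0 <= sexp 1 t.
Proof. by rewrite /sexp; case: ltP => // _; rewrite hornerE mul1r expR_ge0. Qed.

Lemma sexp1_le1 t : sexp 1 t <= 1.
Proof.
rewrite /sexp; case: ltP => // t0; rewrite hornerE mul1r.
by rewrite -expR0 ler_expR oppr_le0 invr_ge0 ltW.
Qed.

Lemma bump_ge0 c d n x : 0 <= bump c d n x.
Proof. by rewrite mulr_ge0 ?sexp1_ge0. Qed.

Lemma bump_le1 c d n x : bump c d n x <= 1.
Proof. by rewrite mulr_ile1 ?sexp1_ge0 ?sexp1_le1. Qed.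

(** The shift by [1] in the arguments of [bump] becomes, after rescaling, this distance from the end
    points; it keeps the support compact in the open interval. *)
Lemma bump_supp c d n x : bump c d n x != 0 ->
  c + n.+1%:R^-1 <= x <= d - n.+1%:R^-1.
Proof.
have n0 : (0 : R) < n.+1%:R by rewrite ltr0n.
rewrite /bump; have [h|h] := ltP 0 (n.+1%:R * x + (- n.+1%:R * c - 1)); last first.
  by rewrite sexp_le0// mul0r eqxx.
have [h' _|h'] := ltP 0 (- n.+1%:R * x + (n.+1%:R * d - 1)); last first.
  by rewrite [X in _ * X]sexp_le0// mulr0 eqxx.
rewrite -(ler_pM2l n0) -[X in _ && X](ler_pM2l n0) mulrDr mulrBr divff ?gt_eqF//.
by apply/andP; split; lra.
Qed.

(** As [exp (- s) >= 1 - s], it is enough that the reciprocal [s] of the argument be at most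
    [eps]. *)
Lemma sexp1_cvg (k : R) : 0 < k ->
  sexp 1 (n.+1%:R * k - 1) @[n --> \oo] --> (1 : R).
Proof.
move=> k0; apply/cvgrPdist_le => eps eps0.
have : \forall n \near \oo, (eps^-1 + 1) / k <= n%:R by exact: nbhs_infty_ger.
apply: filterS => n hn.
have h1 : eps^-1 <= n.+1%:R * k - 1.
  move: hn; rewrite ler_pdivrMr// -natr1 => hn.
  by rewrite mulrDl mul1r; lra.
have e0 : 0 < eps^-1 by rewrite invr_gt0.
have p0 : 0 < n.+1%:R * k - 1 by apply: lt_le_trans h1.
rewrite ger0_norm ?subr_ge0 ?sexp1_le1// sexp_gt0// hornerE mul1r.
have := expR_ge1Dx (- (n.+1%:R * k - 1)^-1).
have : (n.+1%:R * k - 1)^-1 <= eps by rewrite invf_ple// posrE.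
lra.
Qed.

Lemma bump_cvg c d t : bump c d n t @[n --> \oo] --> ((c < t < d)%R%:R : R).
Proof.
have E1 n : n.+1%:R * t + (- n.+1%:R * c - 1) = n.+1%:R * (t - c) - 1 by ring.
have E2 n : - n.+1%:R * t + (n.+1%:R * d - 1) = n.+1%:R * (d - t) - 1 by ring.
rewrite /bump; under eq_fun do rewrite E1 E2.
have le0 n (k : R) : k <= 0 -> n.+1%:R * k - 1 <= 0.
  by move=> k0; have := mulr_ge0_le0 (ler0n R n.+1) k0; lra.
have [ct|tc] := ltP c t; last first.
  under eq_fun do rewrite sexp_le0 ?le0 ?subr_le0// mul0r.
  exact: cvg_cst.
have [td|dt] := ltP t d; last first.
  under eq_fun do rewrite [X in _ * X]sexp_le0 ?le0 ?subr_le0// mulr0.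
  exact: cvg_cst.
have : sexp 1 (n.+1%:R * (t - c) - 1) * sexp 1 (n.+1%:R * (d - t) - 1) @[n --> \oo]
    --> (1 * 1 : R); last by rewrite mulr1.
by apply: cvgM; apply: sexp1_cvg; rewrite ?subr_gt0.
Qed.

(** Dominated convergence with bound [|v|], since bumps take values between [0] and [1]. *)
Lemma int_bump_cvg a b x v : a < x -> x <= b -> itg a b v ->
  prim a (fun t => v t * bump a x n t) b @[n --> \oo] --> prim a v x.
Proof.
move=> ax xb Iv; have ab := lt_le_trans ax xb.
have Ivb n : itg a b (fun t => v t * bump a x n t).
  apply: (@eq_itg _ _ _ (fun t => bump a x n t * v t)) => [t _|]; first exact: mulrC.
  apply: (@itg_mulb _ _ _ _ _ 1) Iv; last first.
    by move=> t _; rewrite ger0_norm ?bump_ge0 ?bump_le1.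
  apply: itg_meas; apply: itg_cts; apply: continuous_subspaceT.
  exact/bump_class_cts/bump_classP.
have J : itg a b (fun t => v t * (a < t < x)%R%:R).
  apply: (@eq_itg _ _ _ (fun t => (a < t < x)%R%:R * v t)) => [t _|]; first exact: mulrC.
  apply: (@itg_mulb _ _ _ _ _ 1) Iv; last first.
    by move=> t _; rewrite normr_nat; case: (_ < _ < _).
  rewrite (_ : (fun t => _) = \1_(`]a, x[%classic)) //.
  by apply/funext => t; rewrite indicE mem_setE in_itv.
have E : prim a v x = prim a (fun t => v t * (a < t < x)%R%:R) b.
  have Ix : itg a x v by apply: itgS Iv.
  rewrite -Rintegral_oo// -Rintegral_oo//.
  rewrite Rintegral_mkcond [RHS]Rintegral_mkcond; apply: eq_Rintegral => t _.
  rewrite !patchE !mem_setE !in_itv/=.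
  have [at_|] := ltP a t; last by [].
  have [tx|xt] := ltP t x; last by rewrite mulr0; case: ifP.
  by rewrite (lt_le_trans tx xb) mulr1.
rewrite E; apply: fine_cvg; rewrite fineK; last exact: integrable_fin_num.
apply: (@dominated_cvg _ _ _ mu _ _ _ _ (fun t => `|v t|%:E)) => //=.
- by move=> n; have /integrableP[] := Ivb n.
- move=> t _; apply: cvg_EFin; first by near=> n.
  by apply: cvgM; [exact: cvg_cst|exact: bump_cvg].
- exact: itg_norm Iv.
- move=> n t _; rewrite lee_fin normrM ler_piMr//.
  by rewrite ger0_norm ?bump_ge0 ?bump_le1.
Unshelve. all: by end_near. Qed.

(** Testing with the antiderivative of a mean-zero combination of bumps on [(a, x)] and [(a, b)]
    relates the integrals of [v] against the two; in the limit the integrals of [v] over these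
    intervals are proportional to their lengths. *)
Lemma du_bois_reymond_prim a b v : a < b -> itg a b v ->
  (forall phi, test_function `]a, b[ phi ->
    \int[mu]_(x in `]a, b[) (v x * derive1n 1 phi x) = 0) ->
  exists K, forall x, a <= x <= b -> prim a v x = K * (x - a).
Proof.
move=> ab Iv hv; exists (prim a v b / (b - a)) => x /andP[].
rewrite le_eqVlt => /predU1P[<- _|ax xb]; first by rewrite primaa subrr mulr0.
have I1 : itg a b (fun=> 1 : R) by exact: itg_cst.
have Ib c d n : itg a b (bump c d n).
  exact/itg_cts/continuous_subspaceT/bump_class_cts/bump_classP.
have Ivb c d n : itg a b (fun t => v t * bump c d n t).
  apply: (@eq_itg _ _ _ (fun t => bump c d n t * v t)) => [t _|]; first exact: mulrC.
  apply: (@itg_mulb _ _ _ _ _ 1) Iv; first exact: itg_meas.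
  by move=> t _; rewrite ger0_norm ?bump_ge0 ?bump_le1.
have key n : prim a (bump a b n) b * prim a (fun t => v t * bump a x n t) b =
             prim a (bump a x n) b * prim a (fun t => v t * bump a b n t) b.
  (* [B * bump a x n - A * bump a b n] has mean zero, hence is the derivative of
     a test function. *)
  set A := prim a (bump a x n) b; set B := prim a (bump a b n) b.
  pose f t := B * bump a x n t + - A * bump a b n t.
  have cf : bump_class f.
    by apply: bump_add; apply: bump_classZ; exact: bump_classP.
  have n0 : (0 : R) < n.+1%:R^-1 by rewrite invr_gt0 ltr0n.
  have ac : a < a + n.+1%:R^-1 by rewrite ltrDl.
  have db : b - n.+1%:R^-1 < b by rewrite ltrBlDr ltrDl.
  have fs t : f t != 0 -> a + n.+1%:R^-1 <= t <= b - n.+1%:R^-1.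
    rewrite /f; have [->|h _] := eqVneq (bump a x n t) 0.
      have [->|h _] := eqVneq (bump a b n t) 0; first by rewrite !mulr0 addr0 eqxx.
      exact: bump_supp h.
    have /andP[-> h2] := bump_supp h; apply: (le_trans h2).
    by rewrite lerD2r.
  have f0 : prim a f b = 0.
    by rewrite primD ?primZ//; [rewrite -/A -/B; ring|exact: itgZ|exact: itgZ].
  have [tf fE] := test_prim ac db cf fs ab f0.
  have := hv _ tf; rewrite fE.
  have := Ivb a x n; have := Ivb a b n; rewrite /f {f cf fs f0 tf fE}.
  move: A B (bump a x n) (bump a b n) => A B p q Ivq Ivp.
  have E : (fun t => v t * (B * p t + - A * q t)) =
           (fun t => B * (v t * p t) + - A * (v t * q t)).
    by apply/funext => t; ring.
  have I1' := itgZ B Ivp; have I2' := itgZ (- A) Ivq.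
  rewrite E (Rintegral_oo ab (itgD I1' I2')) (primD I1' I2') !primZ//; lra.
have lim1 y : a < y -> y <= b -> prim a (bump a y n) b @[n --> \oo] --> y - a.
  move=> ay yb; have := int_bump_cvg ay yb I1; rewrite prim_cst ?ltW// mul1r.
  by under eq_fun do (under eq_prim do rewrite mul1r).
have L : prim a (bump a b n) b * prim a (fun t => v t * bump a x n t) b
    @[n --> \oo] --> (b - a) * prim a v x.
  by apply: cvgM; [exact: lim1|exact: int_bump_cvg].
have L' : prim a (bump a b n) b * prim a (fun t => v t * bump a x n t) b
    @[n --> \oo] --> (x - a) * prim a v b.
  under eq_fun do rewrite key.
  by apply: cvgM; [exact: lim1|exact: int_bump_cvg].
have : (b - a) * prim a v x = (x - a) * prim a v b.
  by rewrite -(cvg_lim (@Rhausdorff R) L) -(cvg_lim (@Rhausdorff R) L').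
have ba0 : b - a != 0 by rewrite subr_eq0 gt_eqF.
by move=> h; apply: (mulfI ba0); rewrite h; field.
Qed.

(** The antiderivative of [v - K] is zero, and by Lebesgue differentiation its derivative is [v - K]
    almost everywhere. *)
Lemma du_bois_reymond a b v : a < b -> itg a b v ->
  (forall phi, test_function `]a, b[ phi ->
    \int[mu]_(x in `]a, b[) (v x * derive1n 1 phi x) = 0) ->
  exists K, {ae mu, forall x, a < x < b -> v x = K}.
Proof.
move=> ab Iv /(du_bois_reymond_prim ab Iv)[K hK]; exists K.
(* Extension by zero keeps the antiderivative zero beyond [b] and makes the function integrable on
   the whole line. *)
pose w := (fun x => v x - K) \_ `[a, b].
have Ivk : itg a b (fun x => v x - K) by apply: itgB => //; exact: itg_cst.
have Iw : mu.-integrable setT (EFin \o w).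
  by rewrite /w -restrict_EFin; apply: (integrable_mkcond _ _).1.
have Iy y : mu.-integrable [set` Interval (BLeft a) (BRight y)] (EFin \o w).
  by apply: integrableS Iw.
have Fw y : a <= y -> prim a w y = 0.
  move=> ay.
  have F1 z : a <= z <= b -> prim a w z = 0.
    move=> /andP[az zb].
    rewrite (@eq_prim _ _ _ _ (fun x => v x - K)).
      rewrite primB ?prim_cst ?hK ?az ?zb ?subrr//; [by apply: itgS Iv|exact: itg_cst].
    move=> t /andP[at_ tz].
    by rewrite /w patchE mem_setE in_itv /= at_ (le_trans tz zb).
  have [yb|by_] := leP y b; first by rewrite F1// ay.
  rewrite (@prim_split _ a b y) ?(ltW ab) ?(ltW by_)//; last exact: Iy.
  rewrite F1 ?lexx ?(ltW ab)// add0r -Rintegral_oo//; last first.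
    by apply: integrableS Iw.
  rewrite (@eq_Rintegral _ _ _ _ _ (fun=> 0)) ?Rintegral_cst ?mul0r// => t.
  rewrite inE /= in_itv /= => /andP[bt _].
  by rewrite /w patchE mem_setE in_itv /= [t <= b]leNgt bt andbF.
have := FTC1 Iy (open_integrable_locally openT Iw).
apply: filterS; first exact: (ae_filter_ringOfSetsType mu).
move=> x h /andP[ax xb].
have [|_] := h; first by rewrite lte_fin.
rewrite /w patchE mem_setE in_itv /= (ltW ax) (ltW xb) /=.
rewrite derive1E (@near_eq_derive _ _ _ _ (cst 0)) ?derive_cst//.
  by move/esym/eqP; rewrite subr_eq0 => /eqP.
near=> y; apply: Fw; apply: ltW; near: y; exact: lt_nbhsr.
Unshelve. all: by end_near. Qed.

End du_bois_reymond.

(** * Identification with the Sobolev-space definitions *)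

Section piecewise_polynomial.
Context {R : realType} (a h : R) (n : nat) (h0 : 0 < h).
Implicit Types (c x y : R) (q : {poly R}).
Local Notation knot := (knot a h).

(** The constant coefficient is a division by zero, that is, [0]. *)
Definition antideriv q : {poly R} := \poly_(i < (size q).+1) (q`_i.-1 / i%:R).

Lemma deriv_antideriv q : (antideriv q)^`() = q.
Proof.
apply/polyP => i; rewrite coef_deriv coef_poly ltnS.
case: ltnP => [_|qi]; last by rewrite mul0rn nth_default.
by rewrite -[LHS]mulr_natr divfK// pnatr_eq0.
Qed.

Lemma prim_horner c x q : c <= x ->
  prim c (horner q) x = (antideriv q).[x] - (antideriv q).[c].
Proof.
move=> cx.
have E : derive1 (horner (antideriv q)) = horner q.
  by apply/funext => y; rewrite derive1E derive_val deriv_antideriv.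
rewrite -E prim_derive//; rewrite E; apply: continuous_subspaceT => y.
exact: continuous_horner.
Qed.

Lemma eq_prim_o x y (f g : R -> R) : itg x y f -> itg x y g ->
  (forall t, x < t <= y -> f t = g t) -> prim x f y = prim x g y.
Proof.
move=> If Ig fg; apply/eqP; rewrite eq_le.
by rewrite !prim_le_o// => t /fg ->.
Qed.

(** On a cell, the antiderivative is its value at the left knot plus the integral of one polynomial.
    The cell is open on the left, like those in [spline]. *)
Lemma spl_poly par p s j : spl a h n par p s -> (j < n)%N ->
  exists2 q : {poly R}, (size q <= p.+1)%N &
    forall x, knot j < x <= knot j.+1 -> s x = q.[x].
Proof.
move=> + jn; elim: p par s => [|p ih] par s /=.
  move=> [c [d ->]]; exists (c + \sum_(i < j) d i)%:P; first exact: size_polyC_leq1.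
  by move=> x xj; rewrite hornerC; exact: spl0_val.
move=> [c [t [st -> _]]]; have [q sq tq] := ih _ _ st.
pose k := c + prim a t (knot j) - (antideriv q).[knot j].
exists (k%:P + antideriv q).
  apply: leq_trans (size_polyD _ _) _; rewrite geq_max.
  rewrite (leq_trans (size_polyC_leq1 _))//=.
  by apply: leq_trans (size_poly _ _) _.
move=> x /andP[jx xj]; rewrite hornerD hornerC.
have aj : a <= knot j by rewrite -[X in X <= _](knot0 a h) knot_le.
have It := spl_itg st.
rewrite (@prim_split _ a (knot j) x) ?(ltW jx)//.
rewrite (@eq_prim_o (knot j) x t (horner q)).
- by rewrite prim_horner ?(ltW jx)// /k; ring.
- by apply: itgS (It x).
- by apply/itg_cts/continuous_subspaceT => y; exact: continuous_horner.
- by move=> y /andP[jy yx]; apply: tq; rewrite jy (le_trans yx).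
Qed.

End piecewise_polynomial.

(** * Comparison of [L2norm] with the inner product on the closed segment *)

Section L2_space.
Context {R : realType}.
Implicit Types (a b : R) (f g : R -> R) (D : set R).
Notation mu := (@lebesgue_measure R).

Lemma L2normE D f : measurable D ->
  L2norm D f = ((\int[mu]_(x in D) (f x ^+ 2)%:E) `^ 2^-1)%E.
Proof.
move=> mD; rewrite /L2norm unlock; congr (_ `^ _)%E.
rewrite [RHS]integral_mkcond; apply: eq_integral => x _.
rewrite /= !patchE; case: ifP => _ /=.
  by rewrite powR_mulrn// real_normK// num_real.
by rewrite normr0 powR0// pnatr_eq0.
Qed.

Lemma eq_L2norm D f g : measurable D -> {in D, f =1 g} -> L2norm D f = L2norm D g.
Proof.
move=> mD fg; rewrite !L2normE//; congr (_ `^ _)%E.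
by apply: eq_integral => x xD; rewrite fg.
Qed.

Lemma ae_eq_L2norm D f g : measurable D -> measurable_fun D f ->
  measurable_fun D g -> {ae mu, forall x, D x -> f x = g x} ->
  L2norm D f = L2norm D g.
Proof.
move=> mD mf mg fg; rewrite !L2normE//; congr (_ `^ _)%E.
apply: ae_eq_integral => //.
- by apply/measurable_EFinP; exact: measurable_funX.
- by apply/measurable_EFinP; exact: measurable_funX.
- move: fg; apply: filterS; first exact: (ae_filter_ringOfSetsType mu).
  by move=> x /[swap] Dx /(_ Dx) ->.
Qed.

Lemma L2norm_sqi a b f : a < b -> sqi a b f ->
  L2norm `]a, b[ f = (Num.sqrt (ip a b f f))%:E.
Proof.
move=> ab [mf If]; rewrite L2normE//.
have I1 : mu.-integrable `]a, b[ (fun x => (f x ^+ 2)%:E).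
  by apply: integrableS If => //; apply: subset_itv; rewrite bnd_simp.
rewrite -[X in (X `^ _)%E]fineK; last exact: integrable_fin_num.
rewrite poweR_EFin; congr (_%:E).
rewrite -[fine _]/(\int[mu]_(x in `]a, b[) (f x ^+ 2)) Rintegral_oo// powR12_sqrt//.
exact: ip_ge0.
Qed.

Lemma sqi_L2 a b f : a < b -> sqi a b f -> L2 `]a, b[ f.
Proof.
move=> ab sf; rewrite /L2 inE /=; apply/andP; split; rewrite inE /=.
  apply/(measurable_restrictT _ _).1 => //; case: sf => mf _.
  by apply: measurable_funS mf => //; apply: subset_itv; rewrite bnd_simp.
by rewrite /finite_norm -/(L2norm _ _) L2norm_sqi// ltry.
Qed.

(** The values of [f] at [a] and [b] are not controlled, while [sqi] refers to the closed segment;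
    hence the extension by zero. *)
Lemma L2norm_fin_sqi a b f : a < b -> measurable_fun `]a, b[ f ->
  (L2norm `]a, b[ f < +oo)%E -> sqi a b (f \_ `]a, b[).
Proof.
move=> ab mf; rewrite L2normE// => /lty_poweRy.
rewrite invr_eq0 pnatr_eq0 => /(_ isT) foo.
have mf' : measurable_fun setT (f \_ `]a, b[).
  exact/(measurable_restrictT _ _).1.
split; first exact: measurable_funS mf'.
have I1 : mu.-integrable `]a, b[ (EFin \o (fun x => f x ^+ 2)).
  apply/integrableP; split; first by apply/measurable_EFinP; exact: measurable_funX.
  apply: le_lt_trans foo; rewrite le_eqVlt; apply/orP; left; apply/eqP.
  apply: eq_integral => x _.
  by rewrite /= ger0_norm// sqr_ge0.
have I2 : mu.-integrable setT (EFin \o ((fun x => f x ^+ 2) \_ `]a, b[)).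
  by rewrite -restrict_EFin; apply: (integrable_mkcond _ _).1.
apply: (@eq_itg _ _ _ ((fun x => f x ^+ 2) \_ `]a, b[)).
  by move=> x _; rewrite !patchE; case: ifP => // _; rewrite expr0n.
by apply: integrableS I2.
Qed.

End L2_space.

(** * Reduced splines and absolutely continuous representatives *)

Section reduced.
Context {R : realType}.
Implicit Types (a b h : R) (n p : nat) (f g u s : R -> R).
Notation mu := (@lebesgue_measure R).

Lemma grid_num_knot a h n : 0 < h -> grid_num a (knot a h n) h = n.
Proof.
move=> h0; rewrite /grid_num /knot [a + _]addrC addrK mulKf ?gt_eqF//.
exact: natrK.
Qed.

(** A derivative of odd order below [p] has parity [false] and positive degree, so it is the
    antiderivative from [a] of a function with integral zero: continuous, and zero at both ends. *)
Lemma spl_reduced_spline a h n p s : 0 < h -> (0 < n)%N -> (0 < p)%N ->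
  spl a h n true p s -> reduced_spline a (knot a h n) p h s.
Proof.
move=> h0 n0 p0 ss.
have ab : a < knot a h n by rewrite -[X in X < _](knot0 a h) knot_lt.
split; [split; [split|]|].
- exact/sqi_L2/spl_sqi/ss.
- move=> k /andP[_ kp]; have [d sd wd] := spl_weak_deriv h0 n0 ss kp.
  by exists d => //; apply: sqi_L2 (spl_sqi sd).
- move=> j; rewrite grid_num_knot// => jn.
  by have [q sq qs] := spl_poly h0 ss jn; exists q.
- move=> l lp; have [d] := spl_weak_deriv h0 n0 ss (ltnW lp).
  rewrite /= odd_double /=; case E : (p - l.*2.+1)%N => [|m].
    by move/eqP: E; rewrite subn_eq0 leqNgt lp.
  move=> [c [t [st dE /(_ isT)[c0 tb]]]] wd.
  have cd : {within `[a, knot a h n], continuous d}.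
    have -> : d = prim a t by apply/funext => x; rewrite dE c0 add0r.
    exact/prim_cts/(spl_itg st).
  split; exists d; split => //; first by rewrite dE c0 primaa addr0.
  by rewrite dE c0 tb addr0.
Qed.

(** Both [u] and the antiderivative of [g] have weak derivative [g], so du Bois-Reymond applies to
    their difference. *)
Lemma weak_deriv1_prim a b u g : a < b -> L2 `]a, b[ u ->
  is_weak_deriv `]a, b[ 1 u g -> (L2norm `]a, b[ g < +oo)%E ->
  exists K, {ae mu, forall x, a < x < b ->
    u x = K + prim a (g \_ `]a, b[) x}.
Proof.
move=> ab Lu [[mu' _ _] [mg _ _] wd] gfin.
have sg := L2norm_fin_sqi ab mg gfin.
have su : sqi a b (u \_ `]a, b[).
  apply: L2norm_fin_sqi => //; move: Lu; rewrite /L2 inE => /andP[_].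
  by rewrite inE.
pose g0 := g \_ `]a, b[; pose u0 := u \_ `]a, b[.
have Ig := sqi_itg sg; have Iu := sqi_itg su.
have IG : itg a b (fun x => 0 + prim a g0 x).
  by apply: itgD; [exact: itg_cst|exact/itg_cts/prim_cts].
have patch0 f x : x \in `]a, b[%classic -> (f \_ `]a, b[) x = f x.
  by move=> xab; rewrite patchE xab.
have Iv : itg a b (fun x => u0 x - (0 + prim a g0 x)) by exact: itgB.
have [phi tphi|K hK] := du_bois_reymond ab Iv.
  have := wd _ tphi; rewrite expr1 mulN1r.
  have -> : \int[mu]_(x in `]a, b[) (u x * derive1n 1 phi x) =
      \int[mu]_(x in `]a, b[) (u0 x * derive1n 1 phi x).
    by apply: eq_Rintegral => x xab; rewrite /u0 patch0.
  have -> : \int[mu]_(x in `]a, b[) (g x * phi x) =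
      \int[mu]_(x in `]a, b[) (g0 x * phi x).
    by apply: eq_Rintegral => x xab; rewrite /g0 patch0.
  have := int_primM_test ab tphi 0 0 Ig; rewrite /= -/g0 => <-.
  have I1 := test_itgM tphi 1 Iu; have I2 := test_itgM tphi 1 IG.
  rewrite !Rintegral_oo// => [uE|]; last first.
    by apply: eq_itg (itgB I1 I2) => x _; rewrite mulrBl.
  have -> : prim a (fun x => (u0 x - (0 + prim a g0 x)) * derive1n 1 phi x) b =
    prim a (fun x => u0 x * derive1n 1 phi x - (0 + prim a g0 x) * derive1n 1 phi x) b.
    by apply: eq_prim => x _; rewrite mulrBl.
  by rewrite primB// uE subrr.
exists K; move: hK; apply: filterS; first exact: (ae_filter_ringOfSetsType mu).
move=> x hx xab; have := hx xab; rewrite /u0 patch0 ?inE//= ?in_itv//= add0r.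
by move=> <-; rewrite subrK.
Qed.

End reduced.

Theorem corollary1 (R : realType) (a b : R) (hab : a < b)
    (u : R -> R) (hu : sobolev `]a, b[ 1 u)
    (h : R) (hh : grid_size a b h)
    (p : nat) (p_gt0 : (0 < p)%N) (hp : h * p%:R < b - a) :
  exists2 uph : R -> R, reduced_spline a b p h uph &
    (L2norm `]a, b[ (u \- uph)%R
       <= (Num.sqrt 2 * h)%:E * sobolev_seminorm `]a, b[ 1 u)%E.
Proof.
case: hh => h0 [n n0 hn].
have bE : b = knot a h n.
  by rewrite /knot -hn mulrA divff ?gt_eqF// mul1r addrC subrK.
have [Lu /(_ 1%N isT)[g1 wg1 _]] := hu.
(* The choice made in [weak_deriv] is a genuine weak derivative, because [g1] is one. *)
have wg : is_weak_deriv `]a, b[ 1 u (weak_deriv `]a, b[ 1 u).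
  exact: (@xgetPex _ _ [set g | is_weak_deriv `]a, b[ 1 u g] (ex_intro _ g1 wg1)).
rewrite /sobolev_seminorm; move: (weak_deriv _ _ _) wg => g wg {g1 wg1}.
have c0 : 0 < Num.sqrt 2 * h by rewrite mulr_gt0// sqrtr_gt0.
(* [g] is an arbitrary weak derivative; if it is not in L^2, the right-hand side
   is infinite. *)
have [goo|gfin] := leP +oo%E (L2norm `]a, b[ g).
  exists (fun=> 0); first by rewrite bE; exact/spl_reduced_spline/spl_zero.
  by move: goo; rewrite leye_eq => /eqP ->; rewrite gt0_muley ?lte_fin// leey.
(* This is the absolutely continuous representative, to which [spl_approx] applies. *)
have [K uE] := weak_deriv1_prim hab Lu wg gfin.
case: wg => -[mu _ _] [mg _ _] _.
have sg := L2norm_fin_sqi hab mg gfin.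
set g0 := g \_ _ in uE sg.
have gE : L2norm `]a, b[ g = L2norm `]a, b[ g0.
  by apply: eq_L2norm => // x xab; rewrite /g0 patchE xab.
have [|//|s [ss es]] := @spl_approx R a h n h0 n0 true p K g0; first by rewrite -bE.
rewrite -bE in es.
exists s; first by rewrite bE; exact: spl_reduced_spline.
have sU : sqi a b (fun x => K + prim a g0 x).
  by apply: sqiD; [exact: sqi_cst|exact/sqi_cts/prim_cts/sqi_itg].
have ss' : sqi a b s by rewrite bE; exact: spl_sqi ss.
have mS f : measurable_fun `[a, b] f -> measurable_fun `]a, b[ f.
  by apply: measurable_funS => //; apply: subset_itv; rewrite bnd_simp.
have se := sqiB sU ss'.
rewrite (@ae_eq_L2norm _ _ _ (fun x => K + prim a g0 x - s x))//; last 3 first.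
- by apply: measurable_funB => //; apply: mS; case: ss'.
- by apply: mS; case: se.
- move: uE; apply: filterS; first exact: (ae_filter_ringOfSetsType lebesgue_measure).
  by move=> x hx; rewrite /= in_itv /= => /hx ->.
rewrite gE !L2norm_sqi// lee_fin.
(* The square root of [es] gives the constant [h], which is then enlarged to [Num.sqrt 2 * h]. *)
apply: le_trans (ler_wsqrtr es) _.
rewrite sqrtrM ?sqr_ge0// sqrtr_sqr (gtr0_norm h0) ler_wpM2r ?sqrtr_ge0//.
rewrite ler_peMl ?(ltW h0)//.
by rewrite -[X in X <= _]sqrtr1 ler_sqrt// ler1n.
Qed.
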